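(* Let $C_0=24e^2$. If $G$ is a finite simple triangle-free graph on $n\geq 1$ vertices, then $$\operatorname{ind}|B_0(G)|\leq C_0\log(2n)\log(2n+2).$$ In particular, if $t\geq 1$ is an integer and $G$ is topologically $t$-chromatic, then $$n\geq \frac12\exp\!\left(\sqrt{(t-1)/C_0}\right)-1.$$ Thus the number of vertices of $G$ grows superpolynomially in $t$.
   Context: All logarithms are natural. For a finite simple graph $G$ with vertex set $V$, write $v^+=(v,+)$ and $v^-=(v,-)$ for $v\in V$, and for $A\subseteq V$ write $A^{\pm}=\{a^{\pm}:a\in A\}$. The box complex $B_0(G)$ is the simplicial complex on the vertex set $V^+\cup V^-$ whose simplices are all sets $$A^+\cup B^-,\qquad A,B\subseteq V,\quad A\cap B=\varnothing,\quad ab\in E(G)\text{ for every }a\in A,\ b\in B;$$ either $A$ or $B$ may be empty (so $V^+$ and $V^-$ are simplices). Exchanging the signs $v^+\leftrightarrow v^-$ is a free simplicial involution; $|B_0(G)|$ denotes the geometric realization with the induced free involution. A free involution on a space is a continuous fixed-point-free involution; a continuous map is equivariant if it commutes with the given involutions. Spheres carry the antipodal involution. For a space $X$ with a free involution, $\operatorname{ind}X=\min\{k\geq0:\text{there is an equivariant map }X\to S^k\}$ (with value $+\infty$ if no such map exists, and $\operatorname{ind}\varnothing=-1$). For an integer $t\geq 1$, a graph $G$ is topologically $t$-chromatic if there is an equivariant map $S^{t-1}\to|B_0(G)|$. *)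

(* Defs.v *)
From HB Require Import structures.
From mathcomp Require Import all_boot all_order all_algebra.
From mathcomp Require Import all_classical all_reals all_analysis.
Import Order.TTheory GRing.Theory Num.Theory.
Import numFieldNormedType.Exports.

Set Implicit Arguments.
Unset Strict Implicit.
Unset Printing Implicit Defensive.

Local Open Scope classical_set_scope.
Local Open Scope ring_scope.

Record sgraph := SGraph {
  vertex :> finType;
  edge : rel vertex;
  edge_sym : symmetric edge;
  edge_irrefl : irreflexive edge }.

Definition triangle_free (G : sgraph) : Prop :=
  forall x y z : G, ~ [/\ edge x y, edge y z & edge x z].

(* The carrier may be empty.                                                  *)
Record freeZ2space := FreeZ2Space {
  Z2carrier :> topologicalType;
  Z2inv : Z2carrier -> Z2carrier;
  Z2inv_continuous : continuous Z2inv;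
  Z2inv_involutive : involutive Z2inv;
  Z2inv_free : forall x, Z2inv x <> x }.

Definition equivariant (X Y : freeZ2space) (f : X -> Y) : Prop :=
  forall x, f (Z2inv x) = Z2inv (f x).

Definition has_equivariant_map (X Y : freeZ2space) : Prop :=
  exists f : X -> Y, continuous f /\ equivariant f.

Lemma set_type_continuous (X Y : topologicalType) (A : set Y) (f : X -> A) :
  continuous (fun x => val (f x)) -> continuous f.
Proof.
move=> cf; apply: (@continuous_comp_initial _ X Y (@set_val Y A) f) => x.
by rewrite set_valE; exact: cf.
Qed.

Lemma val_continuous (Y : topologicalType) (A : set Y) :
  continuous (fun x : A => val x).
Proof.
by have := @initial_continuous A Y (@set_val Y A); rewrite set_valE.
Qed.

Lemma ptws_continuous (X : topologicalType) (I : Type) (Y : topologicalType)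
    (f : X -> {ptws I -> Y}) :
  (forall i, continuous (fun x => f x i)) -> continuous f.
Proof.
move=> cf x; apply/cvg_sup => i.
exact: (@continuous_comp_initial _ X Y (fun g : I -> Y => g i) f (cf i)).
Qed.

Section sphere.
Variables (R : realType) (k : nat).

(* S^k in R^(k+1); the topology of 'rV[R]_(k.+1) is the usual (product) one,  *)
(* but its library norm is the sup norm, hence the explicit sum of squares.   *)
Definition unit_sphere : set 'rV[R]_k.+1 :=
  [set x | \sum_i x ord0 i ^+ 2 = 1].

Lemma unit_sphereN x : unit_sphere x -> unit_sphere (- x).
Proof.
rewrite /unit_sphere /= => <-.
by apply: eq_bigr => i _; rewrite mxE sqrrN.
Qed.

Definition antipode (x : unit_sphere) : unit_sphere :=
  SigSub (mem_set (unit_sphereN (set_valP x))).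

Lemma antipode_continuous : continuous antipode.
Proof.
apply: set_type_continuous => x /=.
by apply: continuousN; exact: val_continuous.
Qed.

Lemma antipodeK : involutive antipode.
Proof. by move=> x; apply: val_inj; rewrite /= opprK. Qed.

Lemma antipode_free x : antipode x <> x.
Proof.
move=> /(congr1 val) /= Nxx.
have x0 i : val x ord0 i = 0.
  have /eqP := congr1 (fun y : 'rV[R]_k.+1 => y ord0 i) Nxx.
  by rewrite mxE eqNr => /eqP.
have /= := set_valP x; rewrite /unit_sphere /= big1 => [/esym/eqP|i _].
  by rewrite oner_eq0.
by rewrite x0 expr0n.
Qed.

Definition sphere : freeZ2space :=
  FreeZ2Space antipode_continuous antipodeK antipode_free.

End sphere.

(* min over k; the infimum of an empty family is +oo, that of a nonempty      *)
(* family of natural numbers is attained.                                     *)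
Definition Z2index (R : realType) (X : freeZ2space) : \bar R :=
  if [set: X] == set0 then (-1)%:E
  else ereal_inf [set k%:R%:E | k in
         [set k : nat | has_equivariant_map X (sphere R k)]].

Record simplicial_complex (T : finType) := SimplicialComplex {
  simplex :> {set T} -> Prop;
  simplex1 : forall v : T, simplex [set v]%SET;
  simplex_sub : forall s t : {set T}, t \subset s -> simplex s -> simplex t }.

(* Barycentric coordinates; T being finite, the subspace topology of the      *)
(* finite power R^T is the weak topology of the complex.                      *)
Definition realization (R : realType) (T : finType) (K : simplicial_complex T) :
    set {ptws T -> R} :=
  [set x | [/\ forall v, 0 <= x v, \sum_v x v = 1
            & K [set v | x v != 0]%SET]].

Section box_complex.
Variable G : sgraph.

Definition plus_copy (A : {set G}) : {set G * bool} :=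
  [set (a, true) | a in A]%SET.
Definition minus_copy (A : {set G}) : {set G * bool} :=
  [set (a, false) | a in A]%SET.

Definition box_simplex (s : {set G * bool}) : Prop :=
  exists A B : {set G}, [/\ A :&: B = finset.set0,
    forall a b, a \in A -> b \in B -> edge a b
    & s = plus_copy A :|: minus_copy B].

Lemma in_plus (A : {set G}) v b : ((v, b) \in plus_copy A) = b && (v \in A).
Proof.
apply/imsetP/andP => [[a aA [-> ->]]|[bt vA]]; first by [].
by exists v => //; rewrite bt.
Qed.

Lemma in_minus (A : {set G}) v b : ((v, b) \in minus_copy A) = ~~ b && (v \in A).
Proof.
apply/imsetP/andP => [[a aA [-> ->]]|[/negbTE bf vA]]; first by [].
by exists v => //; rewrite bf.
Qed.

Lemma box_simplex1 v : box_simplex [set v]%SET.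
Proof.
case: v => v [].
- exists [set v]%SET, finset.set0; split.
  + by rewrite finset.setI0.
  + by move=> a b _; rewrite finset.in_set0.
  + apply/setP => -[w b]; rewrite finset.in_setU in_plus in_minus.
    by rewrite !inE andbF orbF xpair_eqE andbC; case: b.
- exists finset.set0, [set v]%SET; split.
  + by rewrite finset.set0I.
  + by move=> a b; rewrite finset.in_set0.
  + apply/setP => -[w b]; rewrite finset.in_setU in_plus in_minus.
    by rewrite !inE andbF /= xpair_eqE andbC; case: b.
Qed.

Lemma box_simplex_sub (s t : {set G * bool}) :
  t \subset s -> box_simplex s -> box_simplex t.
Proof.
move=> /fintype.subsetP ts [A [B [dAB eAB sAB]]].
pose A' := [set a | (a, true) \in t]%SET.
pose B' := [set a | (a, false) \in t]%SET.
have A'A a : a \in A' -> a \in A.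
  by rewrite inE => /ts; rewrite sAB finset.in_setU in_plus in_minus orbF.
have B'B a : a \in B' -> a \in B.
  by rewrite inE => /ts; rewrite sAB finset.in_setU in_plus in_minus.
exists A', B'; split.
- apply/setP => a; rewrite finset.in_setI finset.in_set0; apply/negP.
  move=> /andP[/A'A aA /B'B aB].
  by have := finset.in_setI a A B; rewrite dAB finset.in_set0 aA aB.
- by move=> a b /A'A aA /B'B bB; exact: eAB.
- apply/setP => -[w b]; rewrite finset.in_setU in_plus in_minus !inE.
  by case: b => //=; rewrite orbF.
Qed.

Definition box_complex : simplicial_complex (G * bool)%type :=
  SimplicialComplex box_simplex1 box_simplex_sub.

Definition swap_sign (v : G * bool) : G * bool := (v.1, ~~ v.2).

Lemma swap_signK : involutive swap_sign.
Proof. by case=> v b; rewrite /swap_sign /= negbK. Qed.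

Lemma box_simplex_swap (s : {set G * bool}) :
  box_simplex s -> box_simplex [set v | swap_sign v \in s]%SET.
Proof.
move=> [A [B [dAB eAB ->]]]; exists B, A; split.
- by rewrite finset.setIC.
- by move=> b a bB aA; rewrite edge_sym; exact: eAB.
- apply/setP => -[w b]; rewrite inE !finset.in_setU !in_plus !in_minus /=.
  by rewrite orbC negbK.
Qed.

Variable R : realType.

Lemma realization_swap (x : {ptws (G * bool)%type -> R}) :
  realization box_complex x ->
  realization box_complex (x \o swap_sign : {ptws (G * bool)%type -> R}).
Proof.
move=> [x0 x1 xs]; split => [v||]; first exact: x0.
- rewrite -x1 [RHS](reindex_inj (inv_inj swap_signK)).
  by apply: eq_bigr.
- have := box_simplex_swap xs; congr box_simplex.
  by apply/setP => v; rewrite !inE.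
Qed.

(* The affine extension of v^+ <-> v^- to the realization.                    *)
Definition box_inv (x : realization (R := R) box_complex) :
    realization (R := R) box_complex :=
  SigSub (mem_set (realization_swap (set_valP x))).

Lemma box_inv_continuous : continuous box_inv.
Proof.
apply: set_type_continuous => x /=.
apply: ptws_continuous => v {}x /=.
apply: (@continuous_comp _ _ _
  (fun x : realization (R := R) box_complex => val x)
  (fun y : {ptws (G * bool)%type -> R} => y (swap_sign v))).
  exact: val_continuous.
exact: (@proj_continuous _ (fun _ => R) (swap_sign v)).
Qed.

Lemma box_invK : involutive box_inv.
Proof.
by move=> x; apply: val_inj; apply/funext => v; rewrite /= swap_signK.
Qed.

Lemma box_inv_free x : box_inv x <> x.
Proof.
move=> /(congr1 val) /= xx.
have [_ x1 [A [B [dAB _ xAB]]]] := set_valP x.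
suff x0 v : val x v = 0.
  by move/eqP: x1; rewrite big1 ?(eq_sym 0) ?oner_eq0.
apply/eqP/negP => /negP xv.
have sx w : (val x w != 0) = (w \in plus_copy A :|: minus_copy B).
  by rewrite -xAB inE.
have xsv : val x (swap_sign v) != 0 by rewrite -[X in X v]xx in xv.
move: xv xsv; rewrite !sx; case: v => v b.
rewrite !finset.in_setU !in_plus !in_minus /= negbK.
by case: b; rewrite /= ?orbF => v1 v2; have := finset.in_setI v A B;
  rewrite dAB finset.in_set0 v1 v2.
Qed.

Definition box_space : freeZ2space :=
  FreeZ2Space box_inv_continuous box_invK box_inv_free.

End box_complex.

(* Meaningful for 1 <= t only.                                                *)
Definition topologically_chromatic (R : realType) (t : nat) (G : sgraph) :
    Prop :=
  has_equivariant_map (sphere R t.-1) (box_space G R).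

Definition C0 (R : realType) : R := 24 * expR 1 ^+ 2.

(* Main.v *)
Require Import Defs.
From mathcomp Require Import all_boot all_order all_algebra.
From mathcomp Require Import all_classical all_reals all_analysis.
From mathcomp Require Import ring lra zify.
Import Order.TTheory GRing.Theory Num.Theory.
Import numFieldNormedType.Exports.

(** Let n be the number of vertices of a triangle-free graph G and let I be the
    set of the 2n signed vertices.

    The index of |B_0(G)| is bounded by constructing k + 1 odd continuous
    functions on it without common zero. Give the pair of signed vertices
    (u, s), (v, t) the weight s t S(u, v), where S is -1 on edges, 1 on equal
    vertices and on non-adjacent vertices with a common neighbour, and 0
    elsewhere. In a simplex that meets both sides, vertices of opposite sides
    are adjacent and vertices of the same side have a common neighbour, so
    this [box_kernel] K is identically 1 there and the quadratic form
    <x, K x> equals 1: the field K x is odd, continuous and nowhere 0 on this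
    part of the complex. But it has as many as 2n coordinates.

    To lower their number, iterate the map y -> K (gibbs y), where the weights
    of [gibbs] are proportional to exp (b y_i), from the field K x. Two things
    happen. First, the iterates stay away from 0: a free energy, which is
    monotone because the log-partition function is convex and K symmetric, is
    at least b initially and would be at most 2 ln |I| near 0
    ([trajectory_norm_ge]); so b only has to exceed 2 ln (2n). Second, the
    iterates become a set of small entropy. A step of the iteration has a
    linear part of Hilbert-Schmidt norm at most 2 in the natural metric, that
    of the square roots of the weights, however large n is. An operator of
    bounded Hilbert-Schmidt norm maps the unit ball into few small balls
    ([hs_cover]), and therefore a step takes a small ball of radius e into
    10 ^ D balls of radius e / 2, where D = 9 b^2 ([flow_cover]).

    After m steps the trajectories of all points are within a multiple of
    2 ^ - m of about 10 ^ (D m) fields. A random form with integer coefficients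
    up to 2 ^ m vanishes near a given one of them with probability about
    2 ^ - m, so 4 D independent forms vanish simultaneously near some of them
    with small probability, because 10 < 2 ^ 4 ([separating_forms]). Together
    with the difference of the masses of the two sides, which is 1 or -1 where
    only one side is charged, such forms give an equivariant map to S^(4 D)
    ([box_map]), with 4 D close to 144 ln^2 (2n), and 144 < 24 e^2.

    The other two claims follow from this bound and the Borsuk-Ulam theorem
    ([borsuk_ulam]), which is derived from a form of Tucker's lemma ([tucker])
    for labellings of an integer grid in a cube, itself proved by counting
    facets modulo 2. *)

Set Implicit Arguments.
Unset Strict Implicit.
Unset Printing Implicit Defensive.

Local Open Scope ring_scope.

(** * Gibbs weights and the free energy of the flow *)

Section gibbs.
Variables (R : realType) (I : finType) (b : R).
Implicit Types y z : I -> R.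

Definition partition_fun y : R := \sum_i expR (b * y i).
Definition gibbs y i : R := expR (b * y i) / partition_fun y.
Definition log_partition y : R := ln (partition_fun y).

Lemma partition_fun_gt0 (i0 : I) y : 0 < partition_fun y.
Proof.
rewrite /partition_fun (bigD1 i0) //= ltr_pwDl ?expR_gt0 //.
by apply: sumr_ge0 => i _; exact: expR_ge0.
Qed.

Lemma gibbs_ge0 y i : 0 <= gibbs y i.
Proof. by rewrite divr_ge0 ?expR_ge0 // ltW // partition_fun_gt0. Qed.

Lemma gibbs_sum (i0 : I) y : \sum_i gibbs y i = 1.
Proof.
by rewrite -mulr_suml divff // gt_eqF // partition_fun_gt0.
Qed.

(** Convexity of the log-partition function: after division by the partition
    function of [y] this is Jensen's inequality for the exponential. *)
Lemma log_partition_tangent (i0 : I) y z :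
  log_partition y + b * \sum_i gibbs y i * (z i - y i) <= log_partition z.
Proof.
set m := b * _.
have Zy := partition_fun_gt0 i0 y; have Zz := partition_fun_gt0 i0 z.
rewrite -ler_expR expRD !lnK ?posrE //.
have -> : partition_fun z =
    partition_fun y * (expR m * \sum_i gibbs y i * expR (b * (z i - y i) - m)).
  rewrite mulr_sumr mulr_sumr [LHS]/partition_fun; apply: eq_bigr => i _.
  rewrite expRD expRN mulrBr expRD expRN /gibbs.
  move: (expR m) (expR_gt0 m) (expR (b * y i)) (expR_gt0 (b * y i)).
  move=> em em0 ey ey0; field.
  by rewrite !gt_eqF.
rewrite ler_pM2l // ler_peMr ?expR_ge0 //.
apply: (@le_trans _ _ (\sum_i gibbs y i * (1 + (b * (z i - y i) - m)))).
  rewrite (eq_bigr (fun i => (1 - m) * gibbs y i + b * (gibbs y i * (z i - y i)))).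
    by rewrite big_split /= -!mulr_sumr gibbs_sum //; rewrite -/m; lra.
  by move=> i _; ring.
by apply: ler_sum => i _; rewrite ler_wpM2l ?gibbs_ge0 // expR_ge1Dx.
Qed.

Lemma log_partition_le (i0 : I) y (c : R) : 0 <= b -> (forall i, y i <= c) ->
  log_partition y <= ln #|I|%:R + b * c.
Proof.
move=> b0 yc; rewrite -[b * c]expRK -lnM ?posrE ?expR_gt0 //; last first.
  by rewrite ltr0n; apply/card_gt0P; exists i0.
rewrite ler_ln ?posrE ?partition_fun_gt0 ?mulr_gt0 ?expR_gt0 //; last first.
  by rewrite ltr0n; apply/card_gt0P; exists i0.
rewrite mulr_natl -sumr_const; apply: ler_sum => i _.
by rewrite ler_expR ler_wpM2l.
Qed.

Lemma log_partition_ge (y x : I -> R) : 0 <= b ->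
  (forall i, 0 <= x i) -> \sum_i x i = 1 ->
  b * \sum_i x i * y i <= log_partition y.
Proof.
move=> b0 x0 x1.
have [i0 _] : exists i0 : I, true.
  case: (pickP (@predT I)) => [i _|no]; first by exists i.
  by move: x1; rewrite big_pred0 // => /eqP; rewrite eq_sym oner_eq0.
rewrite mulr_sumr -[leRHS]mul1r -x1 mulr_suml; apply: ler_sum => i _.
rewrite mulrCA ler_wpM2l // -ler_expR lnK ?posrE ?partition_fun_gt0 //.
rewrite /partition_fun (bigD1 i) //= lerDl.
by apply: sumr_ge0 => j _; exact: expR_ge0.
Qed.

End gibbs.

Section gibbs_flow.
Variables (R : realType) (I : finType) (K : I -> I -> R) (b : R).
Implicit Types y z : I -> R.

Definition field (x : I -> R) i : R := \sum_j K i j * x j.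
Definition flow y : I -> R := field (gibbs b y).
Definition trajectory (x : I -> R) (t : nat) : I -> R := iter t flow (field x).

Hypothesis K_sym : forall i j, K i j = K j i.

Lemma field_adjoint (x z : I -> R) :
  \sum_i x i * field z i = \sum_i z i * field x i.
Proof.
rewrite /field; under eq_bigr do rewrite mulr_sumr.
rewrite exchange_big; apply: eq_bigr => i _; rewrite mulr_sumr.
by apply: eq_bigr => j _; rewrite K_sym; ring.
Qed.

(** A Lyapunov function of the flow, evaluated at two consecutive fields [y]
    and [z], since the iteration need not be monotone for a function of a single
    field when [K] is indefinite. *)
Definition free_energy y z : R :=
  log_partition b z + log_partition b y - b * \sum_i gibbs b y i * y i.

(** By symmetry of [K] the weights of [y] pair with the second iterate as the
    weights of [flow y] pair with [flow y] itself, so the tangent inequality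
    at [y] is exactly the comparison of the two free energies. *)
Lemma free_energy_flow (i0 : I) y :
  free_energy y (flow y) <= free_energy (flow y) (flow (flow y)).
Proof.
rewrite /free_energy.
have := log_partition_tangent b i0 y (flow (flow y)).
rewrite (eq_bigr (fun i => gibbs b y i * flow (flow y) i - gibbs b y i * y i)).
  rewrite sumrB (field_adjoint (gibbs b y) (gibbs b (flow y))) -/(flow y).
  rewrite mulrBr; set A := log_partition b y; set B := log_partition b _.
  set C := b * _; set E := b * _; set F := log_partition b _.
  by clearbody A B C E F; lra.
by move=> i _; rewrite mulrBr.
Qed.

Lemma free_energy_trajectory (i0 : I) x t : 0 <= b ->
  (forall i, 0 <= x i) -> \sum_i x i = 1 ->
  b * \sum_i x i * field x i <= 
  free_energy (trajectory x t) (trajectory x t.+1).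
Proof.
move=> b0 x0 x1; elim: t => [|t IH]; last first.
  by apply: le_trans IH _; exact: free_energy_flow.
rewrite /free_energy /trajectory /= {1}/flow.
have := log_partition_ge (field (gibbs b (field x))) b0 x0 x1.
rewrite field_adjoint.
have := log_partition_ge (field x) b0 x0 x1.
lra.
Qed.

(** The free energy starts above [b] and never decreases, while it is at most
    2 ln |I| + b c at a field bounded by [c]. Hence the trajectory cannot die
    out as soon as [b] exceeds 2 ln |I|. *)
Lemma trajectory_norm_ge (i0 : I) x t (c : R) : 0 <= b ->
  (forall i, 0 <= x i) -> \sum_i x i = 1 -> 1 <= \sum_i x i * field x i ->
  (forall i, trajectory x t.+1 i <= c) ->
  b <= 2 * ln #|I|%:R + b * c.
Proof.
move=> b0 x0 x1 xK yc.
have := free_energy_trajectory i0 t b0 x0 x1.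
have bK : b <= b * \sum_i x i * field x i by rewrite ler_peMr.
have := log_partition_le i0 b0 yc.
have := log_partition_tangent b i0 (trajectory x t) (fun=> 0).
have := @log_partition_le R I b i0 (fun=> 0) 0 b0 (fun=> lexx 0).
rewrite (eq_bigr (fun i => - (gibbs b (trajectory x t) i * trajectory x t i))).
  by rewrite /free_energy sumrN; lra.
by move=> i _; ring.
Qed.

End gibbs_flow.

(** * Amplitudes of Gibbs measures *)

Section hellinger.
Variables (R : realType) (I : finType) (b : R).
Implicit Types y z c : I -> R.

Definition sqnorm (u : I -> R) : R := \sum_i u i ^+ 2.

(** Unit vectors whose Euclidean distance is the Hellinger distance of the
    measures. *)
Definition amplitude y i : R := Num.sqrt (gibbs b y i).

Lemma sqnorm_ge0 u : 0 <= sqnorm u.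
Proof. by apply: sumr_ge0 => i _; exact: sqr_ge0. Qed.

Lemma amplitude_sqr (i0 : I) y i : amplitude y i ^+ 2 = gibbs b y i.
Proof. by rewrite sqr_sqrtr // gibbs_ge0. Qed.

Lemma sqnorm_amplitude (i0 : I) y : sqnorm (amplitude y) = 1.
Proof.
rewrite -(gibbs_sum b i0 y); apply: eq_bigr => i _.
exact: amplitude_sqr.
Qed.

Lemma expR_sub_sqr (s t m : R) : s <= m -> t <= m ->
  (expR s - expR t) ^+ 2 <= (s - t) ^+ 2 * expR (2 * m).
Proof.
wlog ts : s t / t <= s.
  move=> H sm tm; case: (leP t s) => [|/ltW] ts; first exact: H.
  by rewrite -[leLHS]sqrrN opprB -[(s - t) ^+ 2]sqrrN opprB; exact: H.
move=> sm _; rewrite expRM_natl -exprMn ler_pXn2r ?nnegrE //; last 2 first.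
- by rewrite subr_ge0 ler_expR.
- by rewrite mulr_ge0 ?expR_ge0 // subr_ge0.
have -> : expR t = expR s * expR (t - s) by rewrite -expRD; congr expR; ring.
have E := expR_ge1Dx (t - s); have es := expR_gt0 s.
apply: (@le_trans _ _ ((s - t) * expR s)).
  rewrite -subr_ge0; set w := expR (t - s) in E *.
  have -> : (s - t) * expR s - (expR s - expR s * w) = expR s * (w - (1 + (t - s))).
    by ring.
  by rewrite mulr_ge0 ?(ltW es) // subr_ge0.
by rewrite ler_wpM2l ?subr_ge0 // ler_expR.
Qed.

(** The unit vectors in the directions of two vectors [p] and [q] are at squared
    distance 2 - 2 cos, and 2 |p| |q| <= |p|^2 + |q|^2 bounds it by
    |p - q|^2 / (|p| |q|); here [p] and [q] are the exponentials of b y / 2 and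
    b z / 2. *)
Lemma amplitude_dist (i0 : I) y z c (th : R) : 0 <= b ->
  (forall i, `|y i - c i| <= th) -> (forall i, `|z i - c i| <= th) ->
  sqnorm (fun i => amplitude y i - amplitude z i) <=
  b ^+ 2 / 4 * expR (2 * (b * th)) * \sum_i gibbs b c i * (y i - z i) ^+ 2.
Proof.
move=> b0 yc zc.
pose h (a : I -> R) i := expR (b * a i / 2).
have h2 a i : h a i ^+ 2 = expR (b * a i).
  by rewrite /h -expRM_natl; congr expR; field.
pose s := Num.sqrt (partition_fun b y); pose t := Num.sqrt (partition_fun b z).
have Zy := partition_fun_gt0 b i0 y; have Zz := partition_fun_gt0 b i0 z.
have Zc := partition_fun_gt0 b i0 c.
have s0 : 0 < s by rewrite sqrtr_gt0.
have t0 : 0 < t by rewrite sqrtr_gt0.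
have amp a i : amplitude a i = h a i / Num.sqrt (partition_fun b a).
  rewrite /amplitude /gibbs -h2 sqrtrM ?sqr_ge0 // sqrtr_sqr ger0_norm ?expR_ge0 //.
  by rewrite sqrtrV // ltW // partition_fun_gt0.
have sumh a : \sum_i h a i ^+ 2 = partition_fun b a.
  by apply: eq_bigr => i _; rewrite h2.
have step1 : sqnorm (fun i => amplitude y i - amplitude z i) <=
    (\sum_i (h y i - h z i) ^+ 2) / (s * t).
  pose p := \sum_i h y i * h z i.
  have -> : sqnorm (fun i => amplitude y i - amplitude z i) = 2 - 2 * p / (s * t).
    rewrite /sqnorm (eq_bigr (fun i => h y i ^+ 2 / s ^+ 2 + h z i ^+ 2 / t ^+ 2
        - 2 / (s * t) * (h y i * h z i))); last first.
      by move=> i _; rewrite !amp -/s -/t; field; rewrite !gt_eqF.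
    rewrite sumrB big_split /= -!mulr_suml -mulr_sumr !sumh -/p.
    rewrite /s /t !sqr_sqrtr ?(ltW Zy) ?(ltW Zz) // !divff ?gt_eqF //; lra.
  have -> : \sum_i (h y i - h z i) ^+ 2 = s ^+ 2 + t ^+ 2 - 2 * p.
    rewrite (eq_bigr (fun i => h y i ^+ 2 + h z i ^+ 2 - 2 * (h y i * h z i))).
      rewrite sumrB big_split /= -mulr_sumr !sumh /s /t.
      by rewrite !sqr_sqrtr ?(ltW Zy) ?(ltW Zz).
    by move=> i _; ring.
  rewrite ler_pdivlMr ?mulr_gt0 // mulrBl divfK ?gt_eqF ?mulr_gt0 //.
  by clearbody s t p; have := sqr_ge0 (s - t); rewrite sqrrB; lra.
apply: le_trans step1 _.
rewrite ler_pdivrMr ?mulr_gt0 //.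
have st : partition_fun b c * expR (- (b * th)) <= s * t.
  have key a : (forall i, `|a i - c i| <= th) ->
      partition_fun b c * expR (- (b * th)) <= partition_fun b a.
    move=> ac; rewrite mulr_suml; apply: ler_sum => i _; rewrite -expRD ler_expR.
    rewrite -mulrN -mulrDr ler_wpM2l //.
    by have := ac i; rewrite ler_norml => /andP[]; lra.
  rewrite -sqrtrM ?(ltW Zy) //.
  rewrite -[leLHS]ger0_norm; last by rewrite mulr_ge0 ?expR_ge0 // ltW.
  rewrite -sqrtr_sqr ler_sqrt ?mulr_ge0 ?(ltW Zy) ?(ltW Zz) // expr2.
  by rewrite ler_pM ?key // mulr_ge0 ?expR_ge0 // ltW.
apply: (@le_trans _ _ (b ^+ 2 / 4 * expR (b * th) *
    (\sum_i expR (b * c i) * (y i - z i) ^+ 2))).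
  rewrite mulr_sumr; apply: ler_sum => i _.
  have := @expR_sub_sqr (b * y i / 2) (b * z i / 2) ((b * c i + b * th) / 2).
  have le2 a : `|a - c i| <= th -> b * a / 2 <= (b * c i + b * th) / 2.
    rewrite ler_pM2r // -mulrDr => ac; rewrite ler_wpM2l //.
    by move: ac; rewrite ler_norml => /andP[]; lra.
  move=> /(_ (le2 _ (yc i)) (le2 _ (zc i))); rewrite -/(h y i) -/(h z i).
  move=> /le_trans -> //.
  have -> : 2 * ((b * c i + b * th) / 2) = b * c i + b * th by field.
  by rewrite expRD le_eqVlt; apply/orP; left; apply/eqP; field.
have -> : \sum_i expR (b * c i) * (y i - z i) ^+ 2 =
    partition_fun b c * \sum_i gibbs b c i * (y i - z i) ^+ 2.
  rewrite mulr_sumr; apply: eq_bigr => i _; rewrite /gibbs mulrA.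
  by congr (_ * _); rewrite [RHS]mulrC divfK // gt_eqF.
set S := \sum_i _.
have S0 : 0 <= S.
  by apply: sumr_ge0 => i _; rewrite mulr_ge0 ?sqr_ge0 // gibbs_ge0.
apply: (@le_trans _ _ (b ^+ 2 / 4 * expR (2 * (b * th)) * S *
   (partition_fun b c * expR (- (b * th))))).
  rewrite le_eqVlt; apply/orP; left; apply/eqP.
  rewrite expRN expRM_natl; set e := expR _.
  have e0 : e != 0 by rewrite gt_eqF // expR_gt0.
  by field.
rewrite ler_wpM2l // !mulr_ge0 ?expR_ge0 ?sqr_ge0 ?invr_ge0 //.
Qed.

End hellinger.

(** * Few large directions of a Hilbert-Schmidt operator *)

Section ellipsoid_cover.
Variables (R : realType) (I : finType).
Implicit Types u v z : I -> R.

Definition dot u v : R := \sum_i u i * v i.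

Lemma dotC u v : dot u v = dot v u.
Proof. by apply: eq_bigr => i _; rewrite mulrC. Qed.

Lemma dotvv u : dot u u = sqnorm u.
Proof. by apply: eq_bigr => i _; rewrite expr2. Qed.

Definition lincomb (r : nat) (e : 'I_r -> I -> R) (c : 'I_r -> R) : I -> R :=
  fun i => \sum_k c k * e k i.

Definition orthonormal (r : nat) (e : 'I_r -> I -> R) : Prop :=
  forall k l, dot (e k) (e l) = (k == l)%:R.

Lemma dot_lincomb r (e : 'I_r -> I -> R) c v :
  dot v (lincomb e c) = \sum_k c k * dot v (e k).
Proof.
rewrite /dot /lincomb; under eq_bigr do rewrite mulr_sumr.
rewrite exchange_big; apply: eq_bigr => k _; rewrite mulr_sumr.
by apply: eq_bigr => i _; rewrite mulrCA.
Qed.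

Lemma sqnorm_lincomb r (e : 'I_r -> I -> R) c : orthonormal e ->
  sqnorm (lincomb e c) = \sum_k c k ^+ 2.
Proof.
move=> oe; rewrite -dotvv dot_lincomb; apply: eq_bigr => k _.
rewrite dotC dot_lincomb (bigD1 k) //= oe eqxx big1 ?addr0.
  by rewrite mulr1 expr2.
by move=> l lk; rewrite oe eq_sym (negbTE lk) mulr0.
Qed.

Section residual.
Variables (r : nat) (e : 'I_r -> I -> R).
Hypothesis oe : orthonormal e.

Definition residual z : I -> R :=
  fun i => z i - lincomb e (fun k => dot z (e k)) i.

Lemma residual_orth z k : dot (e k) (residual z) = 0.
Proof.
rewrite /residual /dot; under eq_bigr do rewrite mulrBr.
rewrite sumrB -/(dot (e k) z) -/(dot (e k) (lincomb e _)) dot_lincomb.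
rewrite (bigD1 k) //= oe eqxx mulr1 [X in _ - (_ + X)]big1 ?addr0; last first.
  by move=> l lk; rewrite oe eq_sym (negbTE lk) mulr0.
by rewrite (dotC (e k)) subrr.
Qed.

Lemma dotBr u v w : dot u (fun i => v i - w i) = dot u v - dot u w.
Proof. by rewrite /dot -sumrB; apply: eq_bigr => i _; rewrite mulrBr. Qed.

Lemma sqnorm_residual z :
  sqnorm z = \sum_k dot z (e k) ^+ 2 + sqnorm (residual z).
Proof.
have zl : dot z (lincomb e (fun k => dot z (e k))) = \sum_k dot z (e k) ^+ 2.
  by rewrite dot_lincomb; apply: eq_bigr => k _; rewrite expr2.
have rl : dot (residual z) (lincomb e (fun k => dot z (e k))) = 0.
  by rewrite dot_lincomb big1 // => k _; rewrite (dotC (residual z)) residual_orth mulr0.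
by rewrite -(dotvv (residual z)) {2}/residual dotBr rl subr0 dotC dotBr zl dotvv
  addrC subrK.
Qed.

Lemma bessel z : \sum_k dot z (e k) ^+ 2 <= sqnorm z.
Proof. by rewrite [leRHS]sqnorm_residual lerDl sqnorm_ge0. Qed.

End residual.

Variable A : I -> I -> R.

Definition apply_mx z : I -> R := fun i => dot (A i) z.
Definition hs_sqnorm : R := \sum_i sqnorm (A i).

Lemma hs_orthonormal r (e : 'I_r -> I -> R) : orthonormal e ->
  \sum_k sqnorm (apply_mx (e k)) <= hs_sqnorm.
Proof.
move=> oe; rewrite exchange_big; apply: ler_sum => i _.
exact: (bessel oe).
Qed.

(** Directions that [A] stretches by more than the square root of [tau] are
    few, as each contributes [tau] to the Hilbert-Schmidt norm; off their span
    [A] is small. A maximal orthonormal family of such directions plays the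
    part of the singular vectors. *)
Lemma few_large_directions (tau : R) : 0 < tau ->
  exists r (e : 'I_r -> I -> R), [/\ orthonormal e, r%:R * tau <= hs_sqnorm &
    forall z, sqnorm (apply_mx (residual e z)) <= tau * sqnorm z].
Proof.
move=> tau0.
pose P r := exists e : 'I_r -> I -> R, orthonormal e /\
  forall k, tau < sqnorm (apply_mx (e k)).
have Pbound r : P r -> r%:R * tau <= hs_sqnorm.
  move=> [e [oe te]]; apply: le_trans (hs_orthonormal oe).
  rewrite mulr_natl -[r in leLHS]card_ord -sumr_const; apply: ler_sum => k _.
  exact: ltW.
have ex0 : exists r, `[< P r >].
  by exists 0%N; apply/asboolP; exists (fun=> fun=> 0); split=> -[].
have ub r : `[< P r >] -> (r <= Num.truncn (hs_sqnorm / tau))%N.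
  move=> /asboolP /Pbound H.
  rewrite truncn_ge_nat ?ler_pdivlMr //.
  by rewrite mul0r (le_trans _ H) // mulr_ge0 // ltW.
case: (ex_maxnP ex0 ub) => r /asboolP Pr rmax.
have [e [oe te]] := Pr; exists r, e; split => //; first exact: Pbound.
move=> z; rewrite leNgt; apply/negP => bad.
have lez : sqnorm (residual e z) <= sqnorm z.
  rewrite [leRHS](sqnorm_residual oe) lerDr.
  by apply: sumr_ge0 => k _; exact: sqr_ge0.
set w := residual e z in bad lez.
have w0 : 0 < sqnorm w.
  rewrite lt_def sqnorm_ge0 andbT; apply: contraL bad => /eqP w0.
  rewrite -leNgt; suff -> : sqnorm (apply_mx w) = 0.
    by rewrite mulr_ge0 ?sqnorm_ge0 // ltW.
  have wi i : w i = 0.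
    apply/eqP; rewrite -sqrf_eq0; apply/eqP.
    have /eqP := w0; rewrite psumr_eq0 => [/allP/(_ i)|j _]; last exact: sqr_ge0.
    by rewrite mem_index_enum => /(_ isT) /eqP.
  apply: big1 => i _; rewrite /apply_mx /dot big1 ?expr0n // => j _.
  by rewrite wi mulr0.
pose n := Num.sqrt (sqnorm w).
have n0 : 0 < n by rewrite sqrtr_gt0.
pose f (k : 'I_r.+1) : I -> R :=
  if unlift ord_max k is Some k' then e k' else fun i => w i / n.
have dotw k : dot (e k) (fun i => w i / n) = 0.
  rewrite /dot; under eq_bigr do rewrite mulrA.
  by rewrite -mulr_suml [X in X / _](residual_orth oe) mul0r.
have : P r.+1.
  exists f; split.
    move=> k l; rewrite /f.
    case: (unliftP ord_max k) => [k'|] ->; case: (unliftP ord_max l) => [l'|] ->.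
    - by rewrite oe (inj_eq lift_inj).
    - by rewrite dotw eq_sym (negbTE (neq_lift _ _)).
    - by rewrite dotC dotw (negbTE (neq_lift _ _)).
    - rewrite eqxx dotvv /sqnorm; under eq_bigr do rewrite exprMn exprVn.
      by rewrite -mulr_suml sqr_sqrtr ?(ltW w0) // divff // gt_eqF.
  move=> k; rewrite /f; case: (unliftP ord_max k) => [k'|] _ //.
  have -> : sqnorm (apply_mx (fun i => w i / n)) = sqnorm (apply_mx w) / sqnorm w.
    rewrite /sqnorm mulr_suml; apply: eq_bigr => i _.
    rewrite /apply_mx /dot; under eq_bigr do rewrite mulrA.
    by rewrite -mulr_suml exprMn exprVn sqr_sqrtr // ltW.
  by rewrite ltr_pdivlMr // (le_lt_trans _ bad) // ler_wpM2l // ltW.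
by move=> /asboolT /rmax; rewrite ltnn.
Qed.

End ellipsoid_cover.

(** * Rounding coefficients and counting codes *)

Section rounding.
Variables (R : realType) (I : finType).
Implicit Types u v w : I -> R.

(** Rounding [f] to 1 with probability [f] adds nothing on average to the term
    linear in [u], and f (1 - f) <= 1/4 to the quadratic one. *)
Lemma round_one w u (f : R) : 0 <= f <= 1 -> exists m : bool,
  sqnorm (fun i => w i + (f - m%:R) * u i) <= sqnorm w + 4^-1 * sqnorm u.
Proof.
move=> /andP[f0 f1].
have E (c : R) : sqnorm (fun i => w i + c * u i) =
    sqnorm w + (2 * c * dot w u + c ^+ 2 * sqnorm u).
  rewrite /sqnorm /dot !mulr_sumr -!big_split /=; apply: eq_bigr => i _; ring.
have U0 := sqnorm_ge0 u.
case: (leP (sqnorm (fun i => w i + (f - false%:R) * u i))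
  (sqnorm w + 4^-1 * sqnorm u)) => [?|]; first by exists false.
rewrite E subr0 ltrD2l => p; exists true; rewrite E lerD2l leNgt; apply/negP => q.
move: p q; move: (dot w u) (sqnorm u) U0 => d U U0 p q.
have H1 : 0 <= (1 - f) * (2 * f * d + f ^+ 2 * U - 4^-1 * U).
  by rewrite mulr_ge0 ?subr_ge0 // ltW.
have H2 : 0 <= f * (2 * (f - 1) * d + (f - 1) ^+ 2 * U - 4^-1 * U).
  by rewrite mulr_ge0 ?subr_ge0 // ltW.
have H3 : 0 <= U * (2 * f - 1) ^+ 2 by rewrite mulr_ge0 ?sqr_ge0.
have p' : 0 < 2 * f * d + f ^+ 2 * U - 4^-1 * U by rewrite subr_gt0.
have q' : 0 < 2 * (f - 1) * d + (f - 1) ^+ 2 * U - 4^-1 * U by rewrite subr_gt0.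
have [f2|f2] := leP f 2^-1.
  have : 0 < (1 - f) * (2 * f * d + f ^+ 2 * U - 4^-1 * U).
    by rewrite mulr_gt0 //; lra.
  by move: H2 H3; nra.
have : 0 < f * (2 * (f - 1) * d + (f - 1) ^+ 2 * U - 4^-1 * U).
  by rewrite mulr_gt0 //; lra.
by move: H1 H3; nra.
Qed.

(** Independent unbiased rounding has variance at most 1/4 per coefficient,
    so the expected squared error only sees the squared norms of the [u t];
    choosing the roundings one after the other realises this expectation. *)
Lemma round_coefficients (T : eqType) (s : seq T) (f : T -> R) (u : T -> I -> R) w :
  uniq s -> (forall t, 0 <= f t <= 1) -> exists m : T -> bool,
  sqnorm (fun i => w i + \sum_(t <- s) (f t - (m t)%:R) * u t i) <=
  sqnorm w + 4^-1 * \sum_(t <- s) sqnorm (u t).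
Proof.
move=> us f01; elim: s w us => [|t s IH] w /= us.
  exists (fun=> false); rewrite big_nil mulr0 addr0 le_eqVlt; apply/orP; left.
  by apply/eqP/eq_bigr => i _; rewrite big_nil addr0.
have [ts {}us] := andP us.
have [b Hb] := round_one w (u t) (f01 t).
have [m Hm] := IH (fun i => w i + (f t - b%:R) * u t i) us.
exists (fun x => if x == t then b else m x).
rewrite big_cons mulrDr addrA; apply: le_trans (lerD Hb (lexx _)).
apply: le_trans Hm; rewrite le_eqVlt; apply/orP; left; apply/eqP.
apply: eq_bigr => i _; congr (_ ^+ 2); rewrite big_cons eqxx addrA.
congr (_ + _); apply: eq_big_seq => x xs; case: eqP => // xt.
by rewrite -xt xs in ts.
Qed.

End rounding.

Section codes.
Variables (R : realType) (B : nat).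

(** The integers of absolute value at most [B.+1], negative ones on the left.
    The cost max(|n| - 1, 0) is what a rounded coordinate can be charged to the
    square of the coordinate. *)
Definition digit : finType := ('I_B.+1 + 'I_B.+2)%type.

Definition digit_val (d : digit) : R :=
  match d with inl j => - (j.+1)%:R | inr j => (j : nat)%:R end.

Definition digit_cost (d : digit) : nat :=
  match d with inl j => j | inr j => j.-1 end.

Definition digit_of (m : int) : digit :=
  match m with Posz n => inr (inord n) | Negz n => inl (inord n) end.

Lemma digit_ofK (m : int) : ((absz m).-1 <= B)%N ->
  digit_val (digit_of m) = m%:~R /\ digit_cost (digit_of m) = (absz m).-1.
Proof.
case: m => n /= nB; rewrite inordK //.
by case: n nB.
Qed.

Lemma geometric_half_le (n : nat) : \sum_(j < n) (2^-1 : R) ^+ j <= 2.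
Proof.
suff -> : \sum_(j < n) (2^-1 : R) ^+ j = 2 - 2 * 2^-1 ^+ n.
  by rewrite lerBlDr lerDl mulr_ge0 // exprn_ge0 // invr_ge0.
by elim: n => [|n IH]; [rewrite big_ord0; lra|rewrite big_ord_recr /= IH exprS; lra].
Qed.

Lemma digit_weights_le : \sum_(d : digit) (2^-1 : R) ^+ digit_cost d <= 5.
Proof.
rewrite big_sumType /= [X in _ + X]big_ord_recl /= expr0.
rewrite [X in 1 + X](eq_bigr (fun j : 'I_B.+1 => 2^-1 ^+ j)) //.
by have := geometric_half_le B.+1; lra.
Qed.

(** A generating function bound: weighting a code by 2^-cost, the total weight
    of all codes of length r factors into r equal sums, each at most 5. *)
Lemma card_codes (r D : nat) :
  (#|{: {f : {ffun 'I_r -> digit} | (\sum_k digit_cost (f k) <= D)%N}}|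
     <= 2 ^ D * 5 ^ r)%N.
Proof.
rewrite card_sig -(@ler_nat R) natrM !natrX.
set S := [pred f : {ffun 'I_r -> digit} | _].
apply: (@le_trans _ _ (2 ^+ D * \sum_(f in S) (2^-1 : R) ^+ (\sum_k digit_cost (f k))%N)).
  rewrite mulr_sumr -sumr_const; apply: ler_sum => f; rewrite inE => fD.
  rewrite -(subnK fD) exprD -mulrA -exprMn divff ?pnatr_eq0 // expr1n mulr1.
  by rewrite exprn_ege1 // ler1n.
rewrite ler_wpM2l ?exprn_ge0 //.
apply: (@le_trans _ _ (\sum_(f : {ffun 'I_r -> digit}) \prod_k (2^-1 : R) ^+ digit_cost (f k))).
  rewrite [leRHS](bigID S) /=.
  apply: (@le_trans _ _ (\sum_(f in S) \prod_k (2^-1 : R) ^+ digit_cost (f k))).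
    by apply: ler_sum => f _; rewrite expr_sum.
  by rewrite lerDl; apply: sumr_ge0 => f _; apply: prodr_ge0 => k _; rewrite exprn_ge0.
rewrite -(bigA_distr_bigA (fun (_ : 'I_r) (d : digit) => (2^-1 : R) ^+ digit_cost d)).
rewrite prodr_const card_ord.
rewrite lerXn2r ?nnegrE //; first by apply: sumr_ge0 => d _; rewrite exprn_ge0.
exact: digit_weights_le.
Qed.

End codes.

(** * Covering the image of the unit ball *)

Section hs_cover.
Variables (R : realType) (I : finType).
Implicit Types z : I -> R.

Lemma floor_round_near (a : R) (m : bool) :
  `|(Num.floor a + m%:Z)%:~R : R| <= `|a| + 1.
Proof.
rewrite rmorphD /=.
have /andP[f1 f2] := floor_itv a.
rewrite rmorphD /= in f2.
have [m0 m1] : (0 <= (m%:Z)%:~R :> R) /\ ((m%:Z)%:~R <= 1 :> R) by case: m.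
rewrite ler_norml; apply/andP; split.
  have : - `|a| <= a by rewrite lerNl -normrN ler_norm.
  move: (`|a|) => b ab; lra.
have : a <= `|a| by exact: ler_norm.
move: (`|a|) => b ab; lra.
Qed.

(** Rounding moves a number by at most 1, and a natural number is at most its
    square. *)
Lemma floor_round_cost (a : R) (m : bool) :
  ((absz (Num.floor a + m%:Z)).-1)%:R <= a ^+ 2.
Proof.
have := floor_round_near a m; rewrite -intr_norm -abszE.
case: (absz _) => [|[|k]] /=; try by rewrite sqr_ge0.
rewrite -[k.+2]addn1 PoszD rmorphD /= lerD2r -[_%:~R]/((k.+1)%:R) => ka.
rewrite -[leRHS]real_normK ?num_real //; apply: (@le_trans _ _ (k.+1%:R ^+ 2)).
  by rewrite expr2 ler_peMr // ler1n.
by rewrite ler_pXn2r ?nnegrE.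
Qed.

Lemma sqr_near (u v : R) : `|u| <= `|v| + 1 -> u ^+ 2 <= 2 * v ^+ 2 + 2.
Proof.
rewrite -(real_normK (num_real u)) -(real_normK (num_real v)).
move: (normr_ge0 u) (normr_ge0 v); move: (`|u|) (`|v|) => x y x0 y0 xy.
have : x ^+ 2 <= (y + 1) ^+ 2 by rewrite ler_pXn2r ?nnegrE ?addr_ge0.
by have := sqr_ge0 (y - 1); rewrite !expr2; nra.
Qed.

(** No factor depends on the dimension. Off the few large directions the
    operator is small; inside their span the coordinates are rounded to
    multiples of D^(-1/2), with an error governed by the Hilbert-Schmidt norm
    alone. Bessel's inequality bounds the total cost of the roundings by [D],
    and [card_codes] counts the codes of that cost. *)
Lemma hs_cover (A : I -> I -> R) (D : nat) (h : R) :
  (0 < D)%N -> 0 < h -> hs_sqnorm A <= h ->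
  exists (J : finType) (c : J -> I -> R), (#|J| <= 10 ^ D)%N /\
  forall z, sqnorm z <= 1 -> exists j : J,
    sqnorm (apply_mx A (fun i => z i - c j i)) <= 5 / 4 * (h / D%:R) /\
    sqnorm (c j) <= 4.
Proof.
move=> D0 h0 Ah.
have D0R : 0 < D%:R :> R by rewrite ltr0n.
have tau0 : 0 < h / D%:R by rewrite divr_gt0.
have [r [e [oe rh small]]] := few_large_directions A tau0.
have rD : (r <= D)%N.
  have := le_trans rh Ah; rewrite mulrA ler_pdivrMr // mulrC.
  by rewrite ler_pM2l // ler_nat.
exists {f : {ffun 'I_r -> digit D} | (\sum_k digit_cost (f k) <= D)%N}.
pose s : R := Num.sqrt D%:R.
have s0 : 0 < s by rewrite sqrtr_gt0.
have s2 : s ^+ 2 = D%:R by rewrite sqr_sqrtr // ltW.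
exists (fun f : {f : {ffun 'I_r -> digit D} | (\sum_k digit_cost (f k) <= D)%N} =>
  lincomb e (fun k => digit_val R (proj1_sig f k) / s)); split.
  apply: leq_trans (card_codes R _ _ _) _.
  by rewrite (_ : 10 = 2 * 5)%N // expnMn leq_mul2l leq_exp2l // rD orbT.
move=> z z1.
pose a k := dot z (e k) * s.
have suma : \sum_k a k ^+ 2 <= D%:R.
  under eq_bigr do rewrite exprMn.
  by rewrite -mulr_suml s2 ler_piMl ?(ltW D0R) // (le_trans (bessel oe z)).
pose f k := a k - (Num.floor (a k))%:~R.
have f01 k : 0 <= f k <= 1.
  have /andP[f1 f2] := floor_itv (a k); rewrite /f.
  rewrite rmorphD /= in f2; apply/andP; split; lra.
have [m Hm] := round_coefficients (fun k i => apply_mx A (e k) i / s)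
  (apply_mx A (residual e z)) (index_enum_uniq _) f01.
pose n k := Num.floor (a k) + (m k)%:Z.
have cost_le k : ((absz (n k)).-1)%:R <= a k ^+ 2 by exact: floor_round_cost.
have ak k : a k ^+ 2 <= D%:R.
  apply: le_trans suma; rewrite (bigD1 k) //= lerDl.
  by apply: sumr_ge0 => l _; exact: sqr_ge0.
have small_digit k : ((absz (n k)).-1 <= D)%N.
  by rewrite -(@ler_nat R) (le_trans (cost_le k)).
pose F := [ffun k => digit_of D (n k)].
have FD : (\sum_k digit_cost (F k) <= D)%N.
  rewrite -(@ler_nat R) natr_sum (le_trans _ suma) //.
  apply: ler_sum => k _; rewrite ffunE.
  by have [_ ->] := digit_ofK R (small_digit k).
exists (exist _ F FD) => /=.
have Fval k : digit_val R (F k) = (n k)%:~R.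
  by rewrite ffunE; have [->] := digit_ofK R (small_digit k).
split; last first.
  rewrite sqnorm_lincomb //; under eq_bigr do rewrite Fval exprMn exprVn s2.
  rewrite -mulr_suml ler_pdivrMr //.
  apply: (@le_trans _ _ (\sum_k (2 * a k ^+ 2 + 2))).
    by apply: ler_sum => k _; apply: sqr_near; exact: floor_round_near.
  rewrite big_split /= -mulr_sumr sumr_const card_ord.
  have : 2 *+ r <= 2 * D%:R :> R by rewrite -mulr_natr ler_pM2l // ler_nat.
  by move: (2 *+ r) (\sum_i _) suma => x y; lra.
have -> : sqnorm (apply_mx A (fun i => z i -
      lincomb e (fun k => digit_val R (F k) / s) i)) =
  sqnorm (fun i => apply_mx A (residual e z) i +
    \sum_(t <- index_enum 'I_r) (f t - (m t)%:R) * (apply_mx A (e t) i / s)).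
  apply: eq_bigr => i _; congr (_ ^+ 2).
  rewrite /apply_mx /residual !dotBr -addrA; congr (_ + _).
  rewrite !dot_lincomb -sumrN -sumrN -big_split /=; apply: eq_bigr => k _.
  rewrite Fval /n /f rmorphD /= -[(m k)%:~R]/((m k)%:R) /a.
  by field; rewrite gt_eqF.
apply: (le_trans Hm).
have -> : 5 / 4 * (h / D%:R) = h / D%:R + 4^-1 * (h / D%:R) by field; rewrite gt_eqF.
rewrite lerD //.
  by apply: le_trans (small z) _; rewrite ger_pMr.
rewrite ler_pM2l ?invr_gt0 //.
under eq_bigr do (rewrite /sqnorm; under eq_bigr do rewrite exprMn exprVn s2;
  rewrite -mulr_suml).
by rewrite -mulr_suml ler_pM2r ?invr_gt0 // (le_trans (hs_orthonormal A oe)).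
Qed.

End hs_cover.

(** * One step of the flow on a small cluster *)

Section flow_cover.
Variables (R : realType) (I : finType) (K : I -> I -> R) (b : R) (D : nat).
Hypothesis K1 : forall i j, `|K i j| <= 1.
Implicit Types u v y : I -> R.

Lemma sqnormB_le u v :
  sqnorm (fun i => u i - v i) <= 2 * sqnorm u + 2 * sqnorm v.
Proof.
rewrite /sqnorm !mulr_sumr -big_split /=; apply: ler_sum => i _.
by have := sqr_ge0 (u i + v i); rewrite !expr2; nra.
Qed.

Lemma sqnormZ (a : R) u : sqnorm (fun i => a * u i) = a ^+ 2 * sqnorm u.
Proof. by rewrite /sqnorm mulr_sumr; apply: eq_bigr => i _; rewrite exprMn. Qed.

Lemma kernel_sum_le i (v : I -> R) :
  `|\sum_j K i j * v j| <= \sum_j `|v j|.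
Proof.
apply: le_trans (ler_norm_sum _ _ _) _; apply: ler_sum => j _.
by rewrite normrM ler_piMl.
Qed.

(** The arithmetic-geometric mean stands in for the Cauchy-Schwarz inequality,
    which keeps square roots of norms out of the later estimates. *)
Lemma kernel_dot_le i u v (t : R) : 0 < t ->
  `|\sum_j K i j * (u j * v j)| <= (t * sqnorm u + sqnorm v / t) / 2.
Proof.
move=> t0; apply: le_trans (kernel_sum_le _ _) _.
rewrite /sqnorm mulr_sumr mulr_suml -big_split /= mulr_suml.
apply: ler_sum => j _; rewrite normrM -[u j ^+ 2]real_normK ?num_real //.
rewrite -[v j ^+ 2]real_normK ?num_real //.
move: (`|u j|) (`|v j|) => p q.
rewrite -subr_ge0 (_ : _ - _ = (t * p - q) ^+ 2 / (2 * t)); last first.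
  by field; rewrite gt_eqF.
by rewrite divr_ge0 ?sqr_ge0 // mulr_ge0 // ltW.
Qed.

Lemma flow_amplitude (i0 : I) y i :
  flow K b y i = \sum_j K i j * amplitude b y j ^+ 2.
Proof. by apply: eq_bigr => j _; rewrite amplitude_sqr. Qed.

(** In terms of amplitudes the flow is quadratic. Its linear part at a point of
    the cluster has Hilbert-Schmidt norm at most 2 with respect to the weights
    that govern [amplitude_dist], whatever the size of [I], so [hs_cover] needs
    only [10 ^ D] centres; the quadratic remainder is negligible for small
    clusters. The relation between [b] and [D] makes the resulting contraction
    factor smaller than 1/2. *)
Lemma flow_cover (i0 : I) (x0 : I -> R) (e : R) :
  (0 < D)%N -> 0 < b -> 9 * b ^+ 2 = D%:R -> 0 < e -> b * e <= 1 / 200 ->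
  exists (J : finType) (c : J -> I -> R), (#|J| <= 10 ^ D)%N /\
  forall y, sqnorm (fun i => amplitude b y i - x0 i) <= e ^+ 2 ->
  exists j : J,
    sqnorm (fun i => amplitude b (flow K b y) i - c j i) <= (e / 2) ^+ 2.
Proof.
move=> D0 b0 bD e0 be.
have D1 : 1 <= D%:R :> R by rewrite ler1n.
have bge : 1 / 3 <= b.
  rewrite leNgt; apply/negP => lt3.
  have : 0 < (1 / 3 - b) * (1 / 3 + b) by apply: mulr_gt0; lra.
  by move: D1; rewrite -bD expr2; lra.
have e1 : e <= 3 / 200.
  have : 0 <= (b - 1 / 3) * e by rewrite mulr_ge0 ?subr_ge0 // ltW.
  by rewrite mulrBl; lra.
have [[yc Hyc]|none] := pselect (exists y,
    sqnorm (fun i => amplitude b y i - x0 i) <= e ^+ 2); last first.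
  exists unit, (fun=> x0); rewrite card_unit expn_gt0; split=> // y ey.
  by case: none; exists y.
pose c := amplitude b yc.
pose w j := c j - x0 j.
pose pi := gibbs b (flow K b yc).
pose A i j := amplitude b (flow K b yc) i * (2 * K i j * c j).
have c1 : sqnorm c = 1 by exact: sqnorm_amplitude.
have A4 : hs_sqnorm A <= 4.
  apply: (@le_trans _ _ (\sum_i pi i * 4)); last first.
    by rewrite -mulr_suml gibbs_sum // mul1r.
  apply: ler_sum => i _; rewrite sqnormZ amplitude_sqr //.
  rewrite ler_wpM2l ?gibbs_ge0 // (_ : 4 = 4 * sqnorm c); last by rewrite c1 mulr1.
  rewrite /sqnorm mulr_sumr.
  apply: ler_sum => j _; rewrite !exprMn.
  have KK : K i j ^+ 2 <= 1 by rewrite -real_normK ?num_real // expr_le1.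
  have -> : 2 ^+ 2 = 4 :> R by ring.
  by rewrite -mulrA ler_wpM2l // ler_piMl ?sqr_ge0.
have [J [z [cardJ cover]]] := hs_cover D0 (ltr0n R 4) A4.
pose yh (j : J) i := flow K b yc i + \sum_k K i k * ((2 * c k) * (e * z j k - w k)).
exists J, (fun j => amplitude b (yh j)); split=> // y ye.
pose x := amplitude b y.
pose d k := x k - c k.
have d2 : sqnorm d <= 4 * e ^+ 2.
  have -> : sqnorm d = sqnorm (fun i => (x i - x0 i) - w i).
    by apply: eq_bigr => i _; rewrite /d /w; congr (_ ^+ 2); ring.
  apply: le_trans (sqnormB_le _ _) _.
  have : 2 * sqnorm (fun i => x i - x0 i) + 2 * sqnorm w <= 2 * e ^+ 2 + 2 * e ^+ 2.
    by apply: lerD; rewrite ler_pM2l.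
  by move/le_trans; apply; rewrite le_eqVlt; apply/orP; left; apply/eqP; ring.
have z1 : sqnorm (fun k => (x k - x0 k) / e) <= 1.
  rewrite (_ : sqnorm _ = e^-1 ^+ 2 * sqnorm (fun k => x k - x0 k)).
    by rewrite exprVn mulrC ler_pdivrMr ?exprn_gt0 // mul1r.
  by rewrite -sqnormZ; apply: eq_bigr => i _; rewrite mulrC.
have [j [cov cj]] := cover _ z1; exists j.
have s4 : sqnorm (fun k => x k + c k) <= 4.
  rewrite (_ : sqnorm _ = sqnorm (fun k => x k - - c k)); last first.
    by apply: eq_bigr => i _; rewrite opprK.
  apply: le_trans (sqnormB_le _ _) _.
  rewrite (_ : sqnorm (fun k => - c k) = 1).
    by rewrite (sqnorm_amplitude _ i0); lra.
  by rewrite -c1; apply: eq_bigr => i _; rewrite sqrrN.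
(* Both fields compared below stay within [7 * e] of [flow K b yc] in the sup
   norm, as [amplitude_dist] requires. *)
have sup1 i : `|flow K b y i - flow K b yc i| <= 7 * e.
  rewrite !(flow_amplitude i0) -sumrB.
  rewrite (eq_bigr (fun k => K i k * ((x k + c k) * d k))).
    apply: le_trans (kernel_dot_le _ _ _ e0) _.
    have : sqnorm d / e <= 4 * e by rewrite ler_pdivrMr // -mulrA -expr2.
    have : e * sqnorm (fun k => x k + c k) <= e * 4 by rewrite ler_pM2l.
    by move: (_ / e) (e * sqnorm _) => p q; lra.
  by move=> k _; rewrite -/(x k) -/(c k) /d; ring.
have sup2 i : `|yh j i - flow K b yc i| <= 7 * e.
  rewrite /yh addrC addrA addNr add0r.
  have t0 : 0 < 2 * e by rewrite mulr_gt0.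
  apply: le_trans (kernel_dot_le _ _ _ t0) _.
  rewrite sqnormZ c1.
  have ew : sqnorm (fun k => e * z j k - w k) <= 10 * e ^+ 2.
    apply: le_trans (sqnormB_le _ _) _; rewrite sqnormZ.
    have : e ^+ 2 * sqnorm (z j) <= e ^+ 2 * 4 by rewrite ler_pM2l ?exprn_gt0.
    have : sqnorm w <= e ^+ 2 by [].
    by move: (sqnorm w) (_ * sqnorm _) => p q; lra.
  have : sqnorm (fun k => e * z j k - w k) / (2 * e) <= 5 * e.
    rewrite ler_pdivrMr // (_ : 5 * e * (2 * e) = 10 * e ^+ 2) //; ring.
  by move: (_ / (2 * e)) => p; lra.
have := @amplitude_dist R I b i0 (flow K b y) (yh j) (flow K b yc) (7 * e) (ltW b0)
   sup1 sup2.
move=> /le_trans; apply.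
pose r i := \sum_k K i k * d k ^+ 2.
have r4 i : `|r i| <= 4 * e ^+ 2.
  apply: le_trans (kernel_sum_le _ _) (le_trans _ d2).
  by apply: ler_sum => k _; rewrite ger0_norm ?sqr_ge0.
pose L i := \sum_k K i k * ((2 * c k) * ((x k - x0 k) / e - z j k)).
have diff i : flow K b y i - yh j i = e * L i + r i.
  rewrite /yh !(flow_amplitude i0) opprD addrA -sumrB -sumrB mulr_sumr -big_split /=.
  apply: eq_bigr => k _; rewrite -/(x k) -/(c k) /d /w; field.
  by rewrite gt_eqF.
have sumL : \sum_i pi i * L i ^+ 2 <= 5 / D%:R.
  have -> : 5 / D%:R = 5 / 4 * (4 / D%:R) :> R.
    by field; rewrite gt_eqF // ltr0n.
  apply: le_trans cov; apply: ler_sum => i _.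
  rewrite /pi -(amplitude_sqr b i0) -exprMn; rewrite le_eqVlt; apply/orP; left.
  apply/eqP; congr (_ ^+ 2); rewrite /L /apply_mx /dot mulr_sumr.
  by apply: eq_bigr => k _; rewrite /A; ring.
(* (p + q)^2 <= 3/2 p^2 + 3 q^2 separates the linear part from the remainder. *)
have sumE : \sum_i pi i * (flow K b y i - yh j i) ^+ 2 <=
    3 / 2 * e ^+ 2 * (5 / D%:R) + 3 * (16 * e ^+ 4).
  apply: (@le_trans _ _ (\sum_i (3 / 2 * e ^+ 2 * (pi i * L i ^+ 2)
      + 3 * (16 * e ^+ 4) * pi i))).
    apply: ler_sum => i _; rewrite diff.
    have -> : 3 / 2 * e ^+ 2 * (pi i * L i ^+ 2) + 3 * (16 * e ^+ 4) * pi i =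
      pi i * (3 / 2 * (e * L i) ^+ 2 + 3 * (4 * e ^+ 2) ^+ 2) by ring.
    rewrite ler_wpM2l ?gibbs_ge0 //.
    have : r i ^+ 2 <= (4 * e ^+ 2) ^+ 2.
      rewrite -real_normK ?num_real // ler_pXn2r ?nnegrE //.
      by rewrite mulr_ge0 // sqr_ge0.
    move: ((4 * e ^+ 2) ^+ 2) (e * L i) (r i) => B p q qB.
    by have := sqr_ge0 (p - 2 * q); rewrite !expr2 in qB *; lra.
  rewrite big_split /= -!mulr_sumr gibbs_sum // mulr1 lerD2r.
  by rewrite ler_pM2l // mulr_gt0 // exprn_gt0.
(* The exponent is at most 7/100, and exp(-s) >= 1 - s. *)
have exp1 : expR (2 * (b * (7 * e))) <= 11 / 10.
  have := expR_ge1Dx (- (2 * (b * (7 * e)))).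
  rewrite expRN; have := expR_gt0 (2 * (b * (7 * e))).
  move: (expR _) => E E0 H.
  have : 93 / 100 <= E^-1 by apply: le_trans H; nra.
  rewrite -(ler_pM2r E0) mulVf ?gt_eqF //; lra.
apply: (@le_trans _ _ (b ^+ 2 / 4 * (11 / 10) *
    (3 / 2 * e ^+ 2 * (5 / D%:R) + 3 * (16 * e ^+ 4)))).
  rewrite ler_pM //.
  - by rewrite mulr_ge0 ?expR_ge0 // mulr_ge0 ?sqr_ge0.
  - by apply: sumr_ge0 => i _; rewrite mulr_ge0 ?gibbs_ge0 ?sqr_ge0.
  - by rewrite ler_wpM2l // mulr_ge0 ?sqr_ge0.
rewrite -bD.
have -> : b ^+ 2 / 4 * (11 / 10) * (3 / 2 * e ^+ 2 * (5 / (9 * b ^+ 2)) +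
   3 * (16 * e ^+ 4)) = e ^+ 2 * (11 / 48 + 66 / 5 * (b * e) ^+ 2).
  by field; rewrite gt_eqF.
(* 11/48 is below 1/4, and the square of [b * e] fits into the gap. *)
rewrite [leRHS]exprMn ler_pM2l ?exprn_gt0 //.
have : (b * e) ^+ 2 <= (1 / 200) ^+ 2.
  by rewrite ler_pXn2r ?nnegrE // mulr_ge0 ?ltW.
move: ((b * e) ^+ 2) => q; rewrite !expr2; lra.
Qed.

End flow_cover.

(** * Covers of all trajectories and random integer forms *)

Section covers.
Variables (R : realType) (I : finType) (K : I -> I -> R) (b : R) (D : nat).
Hypothesis K1 : forall i j, `|K i j| <= 1.
Implicit Types u v y x : I -> R.

Lemma cover_ord (J : finType) (c : J -> I -> R) (M : nat) :
  (#|J| <= M)%N ->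
  exists c' : 'I_M -> I -> R, forall j, exists k, c' k = c j.
Proof.
move=> JM; exists (fun k => nth (fun=> 0) (map c (enum J)) k) => j.
have jM : (enum_rank j < M)%N by apply: leq_trans JM; exact: ltn_ord.
exists (Ordinal jM) => /=; rewrite (nth_map j) -?cardE ?ltn_ord //.
by rewrite nth_enum_rank.
Qed.

Lemma amplitude_grid (i0 : I) (e : R) : 0 < e ->
  exists (J : finType) (c : J -> I -> R),
  forall y, exists j, sqnorm (fun i => amplitude b y i - c j i) <= e ^+ 2.
Proof.
move=> e0.
pose q := (Num.truncn (#|I|%:R / e)).+1.
have q0 : 0 < q%:R :> R by rewrite ltr0n.
have I1 : 1 <= #|I|%:R :> R by rewrite ler1n; apply/card_gt0P; exists i0.
have Iq : #|I|%:R / e <= q%:R by rewrite ltW // truncnS_gt.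
exists {ffun I -> 'I_q.+1},
  (fun (f : {ffun I -> 'I_q.+1}) i => (f i : nat)%:R / q%:R) => y.
pose t i := Num.truncn (amplitude b y i * q%:R).
exists [ffun i => inord (t i)].
apply: (@le_trans _ _ (\sum_(i : I) q%:R^-1 ^+ 2)).
  apply: ler_sum => i _; rewrite ffunE.
  have a0 : 0 <= amplitude b y i by exact: sqrtr_ge0.
  have a1 : amplitude b y i <= 1.
    have := sqnorm_amplitude b i0 y; rewrite /sqnorm (bigD1 i) //= => s1.
    rewrite -(@ler_pXn2r _ 2) ?nnegrE // expr1n -s1 lerDl.
    by apply: sumr_ge0 => j _; exact: sqr_ge0.
  have aq : 0 <= amplitude b y i * q%:R by rewrite mulr_ge0 // ltW.
  have := truncn_itv aq; rewrite -/(t i) => /andP[t1 t2].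
  rewrite inordK; last first.
    by rewrite ltnS -(@ler_nat R); apply: le_trans t1 _; rewrite ler_piMl // ltW.
  have -> : amplitude b y i - (t i)%:R / q%:R =
      (amplitude b y i * q%:R - (t i)%:R) / q%:R by field; rewrite gt_eqF.
  rewrite exprMn ler_piMl ?sqr_ge0 //.
  rewrite -natr1 in t2; move: t1 t2; move: (_ * _) (_%:R) => p r p1 p2.
  by rewrite expr_le1 //; lra.
rewrite sumr_const -[leLHS]mulr_natl exprVn ler_pdivrMr ?exprn_gt0 // -exprMn.
have I2 : #|I|%:R <= e * q%:R by rewrite mulrC -ler_pdivrMr.
apply: (@le_trans _ _ (#|I|%:R ^+ 2)); last by rewrite ler_pXn2r ?nnegrE // mulr_ge0 // ltW.
by rewrite expr2 ler_peMr.
Qed.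

Lemma trajectory_cover (i0 : I) (e : R) :
  (0 < D)%N -> 0 < b -> 9 * b ^+ 2 = D%:R -> 0 < e -> b * e <= 1 / 200 ->
  exists N : nat, forall m, exists (J : finType) (c : J -> I -> R),
  (#|J| <= N * 10 ^ (D * m))%N /\ forall x, exists j,
  sqnorm (fun i => amplitude b (trajectory K b x m) i - c j i) <= (e / 2 ^+ m) ^+ 2.
Proof.
move=> D0 b0 bD e0 be.
have [J0 [c0 cov0]] := amplitude_grid i0 e0.
exists #|J0|; elim=> [|m [J [c [cardJ cov]]]].
  exists J0, c0; rewrite muln0 muln1; split=> // x.
  by rewrite expr0 divr1; exact: cov0.
have em0 : 0 < e / 2 ^+ m by rewrite divr_gt0 // exprn_gt0.
have bem : b * (e / 2 ^+ m) <= 1 / 200.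
  apply: le_trans be; rewrite ler_pM2l // ler_pdivrMr ?exprn_gt0 //.
  by rewrite ler_peMr ?(ltW e0) // exprn_ege1 // ler1n.
have step j : exists c' : 'I_(10 ^ D) -> I -> R, forall y,
    sqnorm (fun i => amplitude b y i - c j i) <= (e / 2 ^+ m) ^+ 2 ->
    exists k, sqnorm (fun i => amplitude b (flow K b y) i - c' k i)
      <= (e / 2 ^+ m / 2) ^+ 2.
  have [J' [c1 [card1 cov1]]] := flow_cover K1 i0 (c j) D0 b0 bD em0 bem.
  have [c' cc'] := cover_ord c1 card1; exists c' => y /cov1 [k Hk].
  by have [k' ck'] := cc' k; exists k'; rewrite ck'.
have [c' Hc'] := choice step.
exists (J * 'I_(10 ^ D))%type, (fun jk => c' jk.1 jk.2); split.
  by rewrite card_prod card_ord mulnS addnC expnD mulnA leq_mul2r cardJ orbT.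
move=> x; have [j /Hc' [k Hk]] := cov x; exists (j, k) => /=.
by rewrite (exprSr _ m) invfM mulrA.
Qed.

(** A field is a quadratic function of the preceding amplitude, hence Lipschitz
    on the unit ball from the Euclidean norm to the sup norm; one more step
    thus turns clusters of amplitudes into clusters of fields. *)
Lemma field_cover (i0 : I) (e : R) :
  (0 < D)%N -> 0 < b -> 9 * b ^+ 2 = D%:R -> 0 < e -> e <= 1 -> b * e <= 1 / 200 ->
  exists N : nat, forall m, exists (J : finType) (c : J -> I -> R),
  (#|J| <= N * 10 ^ (D * m))%N /\ forall x, exists j, forall i,
  `|trajectory K b x m.+1 i - c j i| <= 6 * (e / 2 ^+ m).
Proof.
move=> D0 b0 bD e0 e1 be.
have [N HN] := trajectory_cover i0 D0 b0 bD e0 be; exists N => m.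
have [J [c [cardJ cov]]] := HN m.
exists J, (fun j i => \sum_k K i k * c j k ^+ 2); split=> // x.
have [j Hj] := cov x; exists j => i.
rewrite [trajectory _ _ _ _ _](flow_amplitude K b i0).
move: Hj; set d := e / 2 ^+ m; set z := amplitude b _ => Hj.
have d0 : 0 < d by rewrite divr_gt0 // exprn_gt0.
have d1 : d <= 1.
  apply: le_trans e1; rewrite ler_pdivrMr ?exprn_gt0 //.
  by rewrite ler_peMr ?(ltW e0) // exprn_ege1 // ler1n.
rewrite -sumrB (eq_bigr (fun k => K i k * ((z k + c j k) * (z k - c j k)))); last first.
  by move=> k _; ring.
apply: le_trans (kernel_dot_le K1 _ _ _ d0) _.
have s1 : sqnorm (fun k => z k + c j k) <= 10.
  rewrite (_ : sqnorm _ = sqnorm (fun k => 2 * z k - (z k - c j k))).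
    apply: le_trans (sqnormB_le _ _) _.
    rewrite sqnormZ (_ : sqnorm z = 1); last exact: sqnorm_amplitude.
    have : d ^+ 2 <= 1 by rewrite expr_le1 // ltW.
    by move: Hj; move: (sqnorm _) (d ^+ 2) => p q; rewrite expr2; lra.
  by apply: eq_bigr => k _; congr (_ ^+ 2); ring.
have s2 : sqnorm (fun k => z k - c j k) / d <= d by rewrite ler_pdivrMr // -expr2.
have s3 : d * sqnorm (fun k => z k + c j k) <= d * 10 by rewrite ler_pM2l.
by move: s2 s3; move: (_ / d) (d * sqnorm _) => p q; lra.
Qed.

End covers.

Section small_forms.
Variables (R : realType) (I : finType).

Definition integer_form (q : nat) (g : {ffun I -> 'I_q.+1}) (v : I -> R) : R :=
  \sum_j (g j : nat)%:R * v j.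

Definition small_forms (q : nat) (v : I -> R) (eta : R) : {set {ffun I -> 'I_q.+1}} :=
  [set g | `|integer_form g v| <= eta]%SET.

(** Once the other coefficients of a form are fixed, its coefficient at [i] is
    determined up to [M.+1] choices: translating the value of the form by
    [eta] and dividing by [v i] labels these choices injectively. *)
Lemma card_small_forms (q M : nat) (v : I -> R) (i : I) (a eta : R) :
  0 < a -> a <= v i -> 0 <= eta -> (eta + eta) / a < M.+1%:R ->
  (#|small_forms q v eta| * q.+1 <= M.+1 * q.+1 ^ #|I|)%N.
Proof.
move=> a0 av eta0 etaM.
have vi0 : 0 < v i by exact: lt_le_trans av.
pose code (g : {ffun I -> 'I_q.+1}) := Num.truncn ((integer_form g v + eta) / v i).
pose put (g : {ffun I -> 'I_q.+1}) (w : 'I_q.+1) := [ffun j => if j == i then w else g j].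
pose F (gw : {ffun I -> 'I_q.+1} * 'I_q.+1) := (inord (code gw.1) : 'I_M.+1, put gw.1 gw.2).
have arg0 g : g \in small_forms q v eta -> 0 <= (integer_form g v + eta) / v i.
  rewrite inE ler_norml => /andP[g1 _].
  by rewrite divr_ge0 ?(ltW vi0) // -lerBlDr sub0r.
have codeM g : g \in small_forms q v eta -> (code g < M.+1)%N.
  move=> gS; rewrite truncn_lt_nat ?arg0 //; apply: le_lt_trans etaM.
  move: gS; rewrite inE ler_norml => /andP[_ g2].
  apply: (@le_trans _ _ ((eta + eta) / v i)).
    by rewrite ler_pM2r ?invr_gt0 // lerD2r.
  by rewrite ler_wpM2l ?addr_ge0 // lef_pV2.
have code_lt g h w w' : g \in small_forms q v eta -> put g w = put h w' ->
    (g i < h i)%N -> (code g < code h)%N.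
  move=> gS /ffunP gh lt_gh; rewrite truncn_gt_nat.
  have /andP[t1 _] := truncn_itv (arg0 _ gS); rewrite -/(code g) in t1.
  rewrite -natr1; apply: le_trans (lerD t1 (lexx 1)) _.
  rewrite ler_pdivlMr // mulrDl divfK ?gt_eqF // mul1r addrAC lerD2r.
  rewrite /integer_form (bigD1 i) //= [leRHS](bigD1 i) //=.
  rewrite (eq_bigr (fun j => (h j : nat)%:R * v j)); last first.
    move=> j ji; have := gh j; rewrite !ffunE (negbTE ji) => -> //.
  rewrite addrAC lerD2r -[X in _ + X]mul1r -mulrDl ler_pM2r // natr1.
  by rewrite ler_nat.
have injF : {in finset.setX (small_forms q v eta) [set: 'I_q.+1]%SET &, injective F}.
  move=> [g w] [h w']; rewrite !finset.in_setX /= => /andP[gS _] /andP[hS _] [].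
  move=> /(congr1 val); rewrite /= !inordK ?codeM // => cgh pgh.
  have gh : g = h.
    apply/ffunP => j; have [->|ji] := eqVneq j i.
      apply: ord_inj; case: (ltngtP (g i) (h i)) => // lt.
        by have := code_lt _ _ _ _ gS pgh lt; rewrite cgh ltnn.
      by have := code_lt _ _ _ _ hS (esym pgh) lt; rewrite cgh ltnn.
    by move/ffunP: pgh => /(_ j); rewrite !ffunE (negbTE ji).
  by move/ffunP: pgh => /(_ i); rewrite !ffunE eqxx gh => ->.
have := max_card (F @: finset.setX (small_forms q v eta) [set: 'I_q.+1]%SET).
by rewrite card_in_imset // cardsX cardsT card_prod card_ffun !card_ord.
Qed.

Lemma growth_16_10 (A : nat) n : (2 * A <= n)%N -> (A * 10 ^ n < 16 ^ n)%N.
Proof.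
move=> An; rewrite -(ltn_pmul2l (isT : 0 < 2)%N) mulnA.
apply: leq_ltn_trans (_ : n * 10 ^ n < _)%N; first by rewrite leq_mul2r An orbT.
elim: n {An} => // n IH; rewrite !expnS.
have : (10 ^ n <= 16 ^ n)%N by case: n {IH} => // n; rewrite leq_exp2r.
lia.
Qed.

(** The union bound: [k] independent integer forms are all small on one centre
    with probability about (M / q)^k at most, while there are only few centres. *)
Lemma good_forms (q M N k : nat) (J : finType) (c : J -> I -> R) (a eta : R) :
  0 < a -> 0 <= eta -> (eta + eta) / a < M.+1%:R ->
  (#|J| <= N)%N -> (N * M.+1 ^ k < q.+1 ^ k)%N ->
  exists G : {ffun 'I_k -> {ffun I -> 'I_q.+1}}, forall j,
    (exists i, a <= c j i) -> exists r, eta < `|integer_form (G r) (c j)|.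
Proof.
move=> a0 eta0 etaM JN NM.
pose B j := [set G : {ffun 'I_k -> {ffun I -> 'I_q.+1}} |
  [forall r, G r \in small_forms q (c j) eta]]%SET.
pose good j := `[< exists i, a <= c j i >].
have cardB j : good j -> (#|B j| * q.+1 ^ k <= M.+1 ^ k * (q.+1 ^ #|I|) ^ k)%N.
  move=> /asboolP [i ai].
  have -> : #|B j| = (#|small_forms q (c j) eta| ^ k)%N.
    have := @card_ffun_on 'I_k {ffun I -> 'I_q.+1} (mem (small_forms q (c j) eta)).
    rewrite card_ord => <-; apply: eq_card => G; rewrite inE.
    by apply/forallP/ffun_onP.
  have := card_small_forms q a0 ai eta0 etaM.
  by rewrite -!expnMn => le; case: k {B NM} => // k'; rewrite leq_exp2r.
have [G HG] : exists G, G \notin \bigcup_(j | good j) B j.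
  apply/existsP; rewrite -negb_forall; apply/negP => /forallP all.
  have full : (#|{: {ffun 'I_k -> {ffun I -> 'I_q.+1}}}| <= \sum_(j | good j) #|B j|)%N.
    apply: leq_trans (_ : #|\bigcup_(j | good j) B j| <= _)%N.
      by apply: subset_leq_card; apply/fintype.subsetP => G _; exact: all.
    elim/big_rec2: _ => [|j n U _ IH]; first by rewrite cards0.
    by apply: leq_trans (leq_card_setU _ _) _; rewrite leq_add2l.
  have : ((\sum_(j | good j) #|B j|) * q.+1 ^ k <= N * (M.+1 ^ k * (q.+1 ^ #|I|) ^ k))%N.
    rewrite big_distrl /=.
    apply: leq_trans (_ : \sum_(j | good j) (M.+1 ^ k * (q.+1 ^ #|I|) ^ k) <= _)%N.
      by apply: leq_sum => j gj; exact: cardB.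
    rewrite sum_nat_const leq_mul2r; apply/orP; right; apply: leq_trans JN.
    exact: max_card.
  have T0 : (0 < (q.+1 ^ #|I|) ^ k)%N by rewrite !expn_gt0.
  have := leq_mul full (leqnn (q.+1 ^ k)).
  rewrite card_ffun !card_ffun !card_ord => l1 l2.
  have := leq_trans l1 l2; rewrite mulnA [leqRHS]mulnC leq_pmul2l //.
  by rewrite leqNgt NM.
exists G => j gj; apply: contrapT => none; case/negP: HG.
apply/bigcupP; exists j; first exact/asboolP.
rewrite inE; apply/forallP => r; rewrite inE leNgt; apply/negP => lt.
by apply: none; exists r.
Qed.

End small_forms.

(** * Integer forms that separate trajectories from zero *)

Section separating_forms.
Variables (R : realType) (I : finType) (K : I -> I -> R) (b : R) (D : nat).

Lemma integer_form_dist (q : nat) (g : {ffun I -> 'I_q.+1}) (v w : I -> R) (d : R) :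
  (forall i, `|v i - w i| <= d) ->
  `|integer_form g v - integer_form g w| <= #|I|%:R * (q%:R * d).
Proof.
move=> vw; rewrite -sumrB; apply: le_trans (ler_norm_sum _ _ _) _.
rewrite mulr_natl -sumr_const; apply: ler_sum => i _.
rewrite -mulrBr normrM normr_nat ler_pM // ler_nat -ltnS; exact: ltn_ord.
Qed.

(** At time [m] the clusters number [10 ^ (D * m)] up to a constant and have
    radius about [2 ^ - m].  A form with coefficients up to [2 ^ m] cannot
    see the inside of a cluster, and it nearly vanishes at a centre with
    probability about [2 ^ - m]; since 10 < 2 ^ 4, [4 * D] independent forms
    separate every cluster from 0 once [m] is large. *)
Lemma separating_forms (i0 : I) :
  (forall i j, K i j = K j i) -> (forall i j, `|K i j| <= 1) ->
  (0 < D)%N -> 0 < b -> 9 * b ^+ 2 = D%:R -> 2 * ln #|I|%:R < b ->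
  exists m q (G : {ffun 'I_(4 * D) -> {ffun I -> 'I_q.+1}}), forall x,
    (forall i, 0 <= x i) -> \sum_i x i = 1 ->
    1 <= \sum_i x i * field K x i ->
    exists r, integer_form (G r) (trajectory K b x m.+1) != 0.
Proof.
move=> Ksym K1 D0 b0 bD lnb.
have [a [a0 aE]] : exists a, 0 < a /\ b * (2 * a) = (b - 2 * ln #|I|%:R) / 2.
  exists ((b - 2 * ln #|I|%:R) / (4 * b)).
  by rewrite divr_gt0 ?subr_gt0 ?mulr_gt0 //; split=> //; field; rewrite gt_eqF.
have [e [e0 e1 ea be]] : exists e, [/\ 0 < e, e <= 1, 6 * e <= a & b * e <= 1 / 200].
  have p : 0 < a / 6 by rewrite divr_gt0.
  have q : 0 < 1 / (200 * b) by rewrite divr_gt0 // mulr_gt0.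
  exists (Num.min (1 / (200 * b)) (Num.min 1 (a / 6))); split.
  - by rewrite !lt_min ltr01 p q.
  - by rewrite !ge_min lexx orbT.
  - by rewrite mulrC -ler_pdivlMr // !ge_min lexx !orbT.
  - rewrite [leRHS](_ : _ = b * (1 / (200 * b))); last by field; rewrite gt_eqF.
    by rewrite ler_pM2l // !ge_min lexx.
pose eta := #|I|%:R * (6 * e).
have eta0 : 0 <= eta by rewrite mulr_ge0 // mulr_ge0 // ltW.
pose M := Num.truncn ((eta + eta) / a).
have [N HN] := field_cover K1 i0 D0 b0 bD e0 e1 be.
pose m := (2 * (N * M.+1 ^ (4 * D)))%N.
have [J [c [cardJ cov]]] := HN m.
have NM : (N * 10 ^ (D * m) * M.+1 ^ (4 * D) < (2 ^ m).+1 ^ (4 * D))%N.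
  rewrite mulnAC; apply: leq_trans (growth_16_10 (_ : 2 * _ <= D * m)%N) _.
    by rewrite -/m leq_pmull.
  have -> : (16 = 2 ^ 4)%N by [].
  rewrite -!expnM; apply: leq_trans (_ : (2 ^ m) ^ (4 * D) <= _)%N.
    by rewrite -expnM mulnA (mulnC (4 * D)%N).
  by rewrite leq_exp2r // muln_gt0.
have [G HG] := good_forms c a0 eta0 (truncnS_gt _) cardJ NM.
exists m, (2 ^ m)%N, G => x x0 x1 xK.
have [i yi] : exists i, 2 * a < trajectory K b x m.+1 i.
  apply: contrapT => none.
  have small i : trajectory K b x m.+1 i <= 2 * a.
    by rewrite leNgt; apply/negP => lt; apply: none; exists i.
  have := trajectory_norm_ge Ksym i0 (ltW b0) x0 x1 xK small.
  by rewrite aE; lra.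
have [j Hj] := cov x.
have d2 : (2 ^ m)%:R * (6 * (e / 2 ^+ m)) = 6 * e.
  by rewrite natrX; field; rewrite expf_neq0.
have cji : a <= c j i.
  have := Hj i; rewrite ler_norml => /andP[_].
  have : 6 * (e / 2 ^+ m) <= a.
    apply: le_trans ea; rewrite ler_pM2l // ler_pdivrMr ?exprn_gt0 //.
    by rewrite ler_peMr ?(ltW e0) // exprn_ege1 // ler1n.
  by move: yi; move: (trajectory _ _ _ _ _) (_ * (_ / _)) => p r; lra.
have [r Hr] := HG j (ex_intro _ i cji); exists r.
apply/eqP => G0; have := integer_form_dist (G r) Hj.
by rewrite G0 sub0r normrN d2 leNgt Hr.
Qed.

End separating_forms.

(** * Continuity and maps to spheres *)

Section continuity.
Variables (R : realType) (X : topologicalType).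

Lemma continuous_sum (I : Type) (s : seq I) (f : I -> X -> R) :
  (forall i, continuous (f i)) -> continuous (fun x => \sum_(i <- s) f i x).
Proof.
move=> cf; elim: s => [|i s IH].
  rewrite (_ : (fun _ => _) = fun=> 0); first exact: cst_continuous.
  by apply/funext => x; rewrite big_nil.
rewrite (_ : (fun _ => _) = fun x => f i x + \sum_(j <- s) f j x); last first.
  by apply/funext => x; rewrite big_cons.
by move=> x; apply: continuousD; [exact: cf|exact: IH].
Qed.

Lemma continuous_mul (f g : X -> R) :
  continuous f -> continuous g -> continuous (fun x => f x * g x).
Proof. by move=> cf cg x; apply: continuousM; [exact: cf|exact: cg]. Qed.

Lemma continuous_scale (a : R) (f : X -> R) :
  continuous f -> continuous (fun x => a * f x).
Proof. by apply: continuous_mul => x; exact: cst_continuous. Qed.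

Lemma continuous_inv (f : X -> R) :
  continuous f -> (forall x, f x != 0) -> continuous (fun x => (f x)^-1).
Proof. by move=> cf f0 x; apply: continuousV; [exact: f0|exact: cf]. Qed.

Lemma rV_continuous n (f : X -> 'rV[R]_n) :
  (forall i, continuous (fun x => f x ord0 i)) -> continuous f.
Proof.
move=> cf x A [P MP sPA].
have : \forall y \near x, forall i, P ord0 i (f y ord0 i).
  by apply: filter_forall => i; exact: (cf i x _ (MP ord0 i)).
by apply: filterS => y Py; apply: sPA => i j; rewrite ord1.
Qed.

Variables (I : finType) (K : I -> I -> R) (b : R).

Lemma field_continuous (u : X -> I -> R) :
  (forall i, continuous (fun x => u x i)) ->
  forall i, continuous (fun x => field K (u x) i).
Proof. by move=> cu i; apply: continuous_sum => j; apply: continuous_scale. Qed.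

Lemma gibbs_continuous (i0 : I) (u : X -> I -> R) :
  (forall i, continuous (fun x => u x i)) ->
  forall i, continuous (fun x => gibbs b (u x) i).
Proof.
move=> cu i.
have ce j : continuous (fun x => expR (b * u x j)).
  move=> x; apply: (@continuous_comp _ _ _ (fun x => b * u x j) expR).
    exact: continuous_scale.
  exact: continuous_expR.
apply: continuous_mul (ce i) _; apply: continuous_inv => [|x].
  exact: continuous_sum.
by rewrite gt_eqF // partition_fun_gt0.
Qed.

Lemma trajectory_continuous (i0 : I) (u : X -> I -> R) t :
  (forall i, continuous (fun x => u x i)) ->
  forall i, continuous (fun x => trajectory K b (u x) t i).
Proof.
move=> cu; elim: t => [|t IH] i; first exact: field_continuous.
by apply: field_continuous => j; exact: gibbs_continuous.
Qed.

Lemma integer_form_continuous q (g : {ffun I -> 'I_q.+1}) (u : X -> I -> R) :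
  (forall i, continuous (fun x => u x i)) ->
  continuous (fun x => integer_form g (u x)).
Proof. by move=> cu; apply: continuous_sum => j; apply: continuous_scale. Qed.

End continuity.

Lemma sqsum_eq0 (R : realType) k (v : 'rV[R]_k) :
  (\sum_i v ord0 i ^+ 2 == 0) = (v == 0).
Proof.
rewrite psumr_eq0 => [|i _]; last exact: sqr_ge0.
apply/allP/eqP => [v0|-> i _]; last by rewrite mxE expr0n /= eqxx.
apply/rowP => i; rewrite mxE; apply/eqP; rewrite -sqrf_eq0.
by apply: (implyP (v0 i _)) => //; exact: mem_index_enum.
Qed.

Lemma sphere_normalization (R : realType) (X : topologicalType) k
    (f : X -> 'rV[R]_k.+1) : continuous f -> (forall x, f x != 0) ->
  exists g : X -> sphere R k, continuous g /\
    forall x, val (g x) = (Num.sqrt (\sum_i f x ord0 i ^+ 2))^-1 *: f x.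
Proof.
move=> cf f0; pose s x := \sum_i f x ord0 i ^+ 2.
have s0 x : 0 < s x.
  rewrite lt_def sqsum_eq0 f0; apply: sumr_ge0 => i _; exact: sqr_ge0.
pose g x := (Num.sqrt (s x))^-1 *: f x.
have gS x : unit_sphere (g x).
  rewrite /unit_sphere /= (eq_bigr (fun i => (s x)^-1 * f x ord0 i ^+ 2)).
    by rewrite -mulr_sumr mulVf // gt_eqF.
  by move=> i _; rewrite mxE exprMn exprVn sqr_sqrtr // ltW.
exists (fun x => SigSub (mem_set (gS x)) : sphere R k); split=> //.
apply: set_type_continuous => /=; apply: rV_continuous => i.
have ci j : continuous (fun x => f x ord0 j).
  move=> y; apply: (@continuous_comp _ _ _ f (fun M : 'rV[R]_k.+1 => M ord0 j)).
    exact: cf.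
  exact: coord_continuous.
rewrite (_ : (fun _ => _) = fun x => (Num.sqrt (s x))^-1 * f x ord0 i); last first.
  by apply/funext => y; rewrite mxE.
apply: continuous_mul (ci i); apply: continuous_inv => [x|x].
  apply: (@continuous_comp _ _ _ s Num.sqrt); last exact: sqrt_continuous.
  by apply: continuous_sum => j; exact: (continuous_mul (ci j) (ci j)).
by rewrite gt_eqF // sqrtr_gt0.
Qed.

Lemma odd_nonvanishing_map (R : realType) (X : freeZ2space) k (f : X -> 'rV[R]_k.+1) :
  continuous f -> (forall x, f (Z2inv x) = - f x) -> (forall x, f x != 0) ->
  has_equivariant_map X (sphere R k).
Proof.
move=> cf oddf f0; have [g [cg gE]] := sphere_normalization cf f0.
exists g; split=> // x; apply: val_inj; rewrite /= !gE oddf scalerN.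
congr (- ((Num.sqrt _)^-1 *: _)).
by apply: eq_bigr => i _; rewrite mxE sqrrN.
Qed.

(** * The kernel of a triangle-free graph *)

Section box_kernel.
Variables (R : realType) (G : sgraph).
Implicit Types (u v w : G) (i j : G * bool).

Definition sign (s : bool) : R := if s then 1 else -1.

Definition adjacency_sign u v : R :=
  if edge u v then -1
  else if (u == v) || [exists w, edge u w && edge v w] then 1 else 0.

(** The kernel is odd in each argument, which makes all fields odd, and its
    quadratic form is 1 at the points of the box complex that charge both
    signs: see [box_kernel_two_sided]. *)
Definition box_kernel i j : R := sign i.2 * sign j.2 * adjacency_sign i.1 j.1.

Lemma box_kernel_sym i j : box_kernel i j = box_kernel j i.
Proof.
rewrite /box_kernel (mulrC (sign i.2)) /adjacency_sign edge_sym eq_sym.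
have -> // : [exists w, edge i.1 w && edge j.1 w] = [exists w, edge j.1 w && edge i.1 w].
by apply: eq_existsb => w; rewrite andbC.
Qed.

Lemma box_kernel_le1 i j : `|box_kernel i j| <= 1.
Proof.
have s1 s : `|sign s| = 1 by case: s; rewrite /= ?normrN normr1.
rewrite !normrM !s1 !mul1r /adjacency_sign.
by case: ifP => _; [|case: ifP => _]; rewrite ?normrN ?normr1 ?normr0.
Qed.

Lemma sign_neg s : sign (~~ s) = - sign s.
Proof. by case: s; rewrite /= ?opprK. Qed.

Lemma box_kernel_swapl i j : box_kernel (swap_sign i) j = - box_kernel i j.
Proof. by rewrite /box_kernel /= sign_neg !mulNr. Qed.

Lemma field_swap (x : G * bool -> R) i :
  field box_kernel (x \o @swap_sign G) i = - field box_kernel x i.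
Proof.
rewrite -sumrN /field [LHS](reindex_inj (inv_inj (@swap_signK G))) /=.
apply: eq_bigr => j _; rewrite swap_signK.
by rewrite box_kernel_sym box_kernel_swapl box_kernel_sym mulNr.
Qed.

Lemma field_odd (x : G * bool -> R) i :
  field box_kernel x (swap_sign i) = - field box_kernel x i.
Proof.
by rewrite /field -sumrN; apply: eq_bigr => j _; rewrite box_kernel_swapl mulNr.
Qed.

Lemma gibbs_swap b (y : G * bool -> R) i :
  gibbs b (y \o @swap_sign G) i = gibbs b y (swap_sign i).
Proof.
congr (_ / _); rewrite [RHS](reindex_inj (inv_inj (@swap_signK G))).
by [].
Qed.

Lemma trajectory_swap b (x : G * bool -> R) t i :
  trajectory box_kernel b x t (swap_sign i) = - trajectory box_kernel b x t i.
Proof. by case: t => [|t]; exact: field_odd. Qed.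

Lemma trajectory_odd b (x : G * bool -> R) t i :
  trajectory box_kernel b (x \o @swap_sign G) t i =
  - trajectory box_kernel b x t i.
Proof.
elim: t i => [|t IH] i; first exact: field_swap.
have -> : trajectory box_kernel b (x \o @swap_sign G) t.+1 =
    field box_kernel (gibbs b (trajectory box_kernel b x t \o @swap_sign G)).
  congr (field _ (gibbs _ _)); apply/funext => k.
  exact: (etrans (IH k) (esym (trajectory_swap b x t k))).
have -> : gibbs b (trajectory box_kernel b x t \o @swap_sign G) =
    gibbs b (trajectory box_kernel b x t) \o @swap_sign G.
  by apply/funext => j; exact: gibbs_swap.
exact: field_swap.
Qed.

(** Without triangles, two vertices on the same side of a simplex meeting both
    sides are non-adjacent and share a neighbour on the other side, so that
    [box_kernel] is identically 1 on such a simplex. *)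
Lemma box_kernel_two_sided (A B : {set G}) i j :
  triangle_free G -> A != finset.set0 -> B != finset.set0 ->
  (forall a b, a \in A -> b \in B -> edge a b) ->
  i \in plus_copy A :|: minus_copy B -> j \in plus_copy A :|: minus_copy B ->
  box_kernel i j = 1.
Proof.
move=> tf /set0Pn[a0 a0A] /set0Pn[b0 b0B] eAB.
have same u v w : edge u w -> edge v w -> adjacency_sign u v = 1.
  move=> uw vw; rewrite /adjacency_sign; case: ifP => [uv|_].
    by case: (tf u v w).
  by case: existsP => [_|no]; [rewrite orbT|case: no; exists w; rewrite uw].
have diff u v : edge u v -> adjacency_sign u v = -1.
  by rewrite /adjacency_sign => ->.
case: i => u []; case: j => v []; rewrite /box_kernel !finset.in_setU
  !in_plus !in_minus /= ?orbF => uX vX.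
- by rewrite (@same u v b0) ?mulr1 ?eAB.
- by rewrite diff ?eAB //; ring.
- by rewrite diff; [ring|rewrite edge_sym eAB].
- by rewrite (@same u v a0); [ring|rewrite edge_sym eAB|rewrite edge_sym eAB].
Qed.

Lemma box_kernel_quadratic (x : realization (R := R) (box_complex G)) :
  triangle_free G ->
  (exists v, val x (v, true) != 0) -> (exists v, val x (v, false) != 0) ->
  1 <= \sum_i val x i * field box_kernel (val x) i.
Proof.
move=> tf [v1 xv1] [v2 xv2].
have [_ x1 [A [B [_ eAB xAB]]]] := set_valP x.
have sx (i : G * bool) : (val x i != 0) = (i \in plus_copy A :|: minus_copy B).
  by rewrite -xAB inE.
have A0 : A != finset.set0.
  apply/set0Pn; exists v1; move: xv1.
  by rewrite sx finset.in_setU in_plus in_minus orbF.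
have B0 : B != finset.set0.
  apply/set0Pn; exists v2; move: xv2.
  by rewrite sx finset.in_setU in_plus in_minus.
have -> : \sum_i val x i * field box_kernel (val x) i = (\sum_i val x i) * (\sum_i val x i).
  rewrite mulr_suml; apply: eq_bigr => i _.
  have [->|xi] := eqVneq (val x i) 0; first by rewrite !mul0r.
  congr (_ * _); apply: eq_bigr => j _.
  have [->|xj] := eqVneq (val x j) 0; first by rewrite mulr0.
  by rewrite (box_kernel_two_sided tf A0 B0 eAB) ?mul1r // -sx.
by rewrite x1 mul1r.
Qed.

End box_kernel.

Section box_map.
Variables (R : realType) (G : sgraph).

Lemma ptws_coord_continuous i :
  continuous (fun x : realization (R := R) (box_complex G) => val x i).
Proof.
move=> x.
apply: (@continuous_comp _ _ _
  (fun x : realization (R := R) (box_complex G) => val x)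
  (fun y : {ptws (G * bool)%type -> R} => y i)).
  exact: val_continuous.
exact: (@proj_continuous _ (fun _ => R) i).
Qed.

(** On the two-sided part of the complex the separating forms do not vanish
    simultaneously; on the rest, which is the disjoint union of the two
    simplices of one sign, the first coordinate is 1 or -1. *)
Lemma box_map (D : nat) : triangle_free G -> (0 < #|G|)%N -> (0 < D)%N ->
  36 * ln (2 * #|G|%:R) ^+ 2 < D%:R :> R ->
  has_equivariant_map (box_space G R) (sphere R (4 * D)).
Proof.
move=> tf /card_gt0P [g0 _] D0 lnD; pose i0 : G * bool := (g0, true).
pose b : R := Num.sqrt D%:R / 3.
have D0R : 0 < D%:R :> R by rewrite ltr0n.
have b0 : 0 < b by rewrite divr_gt0 // sqrtr_gt0.
have bD : 9 * b ^+ 2 = D%:R.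
  by rewrite /b exprMn sqr_sqrtr ?(ltW D0R) // exprVn; field.
have lnb : 2 * ln #|{: G * bool}|%:R < b.
  rewrite card_prod card_bool natrM (mulrC _ 2).
  rewrite ltr_pdivlMr //; case: (leP (ln (2 * #|G|%:R) : R) 0) => l0.
    by apply: (@le_lt_trans _ _ 0); [lra|rewrite sqrtr_gt0].
  rewrite -(@ltr_pXn2r _ 2) ?nnegrE ?sqrtr_ge0 ?mulr_ge0 ?(ltW l0) //.
  rewrite sqr_sqrtr ?(ltW D0R) //; apply: le_lt_trans lnD.
  by rewrite le_eqVlt; apply/orP; left; apply/eqP; ring.
have [m [q [F HF]]] := separating_forms i0 (@box_kernel_sym R G)
  (@box_kernel_le1 R G) D0 b0 bD lnb.
pose y (x : box_space G R) := trajectory (@box_kernel R G) b (val x) m.+1.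
pose balance (x : box_space G R) : R := \sum_i sign R i.2 * val x i.
pose f (x : box_space G R) : 'rV[R]_(4 * D).+1 :=
  \row_k (if unlift ord0 k is Some r then integer_form (F r) (y x) else balance x).
have cx i : continuous (fun x : box_space G R => val x i).
  exact: ptws_coord_continuous.
apply: (@odd_nonvanishing_map _ _ _ f).
- apply: rV_continuous => k; rewrite /f; under eq_fun do rewrite mxE.
  case: (unlift ord0 k) => [r|].
    by apply: integer_form_continuous => i; exact: trajectory_continuous.
  by apply: continuous_sum => i; apply: continuous_scale.
- move=> x; apply/rowP => k; rewrite !mxE; case: (unlift ord0 k) => [r|].
    rewrite /integer_form -sumrN; apply: eq_bigr => i _.
    by rewrite /y [X in _ * X](trajectory_odd b (val x) m.+1) mulrN.
  rewrite /balance -sumrN (reindex_inj (inv_inj (@swap_signK G))).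
  by apply: eq_bigr => i _; rewrite /= swap_signK sign_neg mulNr.
move=> x; apply/eqP => f0.
have coord k : f x ord0 k = 0 by rewrite f0 mxE.
have [x0 x1 _] := set_valP x.
have bal : balance x = 0 by have := coord ord0; rewrite mxE unlift_none.
have one_sided s : (forall v, val x (v, s) = 0) -> False.
  move=> xs; suff : balance x = - sign R s.
    by rewrite bal; case: (s) => /= /eqP; rewrite eq_sym ?opprK ?oppr_eq0 oner_eq0.
  rewrite -[RHS]mulr1 -x1 mulr_sumr; apply: eq_bigr => -[v t] _ /=.
  case: (eqVneq t s) => [->|]; first by rewrite xs !mulr0.
  by case: t; case: (s) => //= _; rewrite ?opprK.
have [] : exists r, integer_form (F r) (y x) != 0.
  apply: HF => //; apply: box_kernel_quadratic => //.
    apply: contrapT => no; apply: (one_sided true) => v.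
    by apply/eqP/negP => /negP xv; apply: no; exists v.
  apply: contrapT => no; apply: (one_sided false) => v.
  by apply/eqP/negP => /negP xv; apply: no; exists v.
move=> r /eqP; apply; have := coord (lift ord0 r).
by rewrite mxE liftK.
Qed.

End box_map.

(** * The bound on the index *)

Section index_bound.
Variable R : realType.

Lemma C0_ge161 : 161 <= C0 R.
Proof.
(* e >= (1 + 1/10)^10 *)
have e1 : 1 + 1 / 10 <= expR (1 / 10) :> R by exact: expR_ge1Dx.
have -> : C0 R = 24 * expR (1 / 10) ^+ 20.
  by rewrite /C0 -!expRM_natl; congr (_ * expR _); field.
have : (1 + 1 / 10) ^+ 20 <= expR (1 / 10) ^+ 20 :> R.
  by rewrite ler_pXn2r // nnegrE ?expR_ge0.
by move: (expR _ ^+ 20) => p; rewrite !exprS expr0; lra.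
Qed.

Lemma ln2_ge_half : 1 / 2 <= ln 2 :> R.
Proof.
rewrite -ler_expR lnK ?posrE //.
have := expR_ge1Dx (- (1 / 2) : R); rewrite expRN.
have := expR_gt0 (1 / 2 : R); move: (expR _) => p p0 H.
have : 1 / 2 <= p^-1 by apply: le_trans H; lra.
by rewrite -(ler_pM2r p0) mulVf ?gt_eqF //; lra.
Qed.

(** For the least admissible [D] the index is at most 4 D <= 144 ln^2 (2n) + 4.
    The constant 4 is absorbed by the difference between [C0] and 144, since
    ln (2n) >= ln 2 and ln (2n + 2) >= 2 ln 2 with ln 2 >= 1/2. *)
Lemma box_index_bound (G : sgraph) : triangle_free G -> (1 <= #|G|)%N ->
  exists k, has_equivariant_map (box_space G R) (sphere R k) /\
    k%:R <= C0 R * ln (2 * #|G|%:R) * ln (2 * #|G|%:R + 2).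
Proof.
move=> tf n1; set n : R := #|G|%:R.
have n1R : 1 <= n by rewrite ler1n.
set L := ln (2 * n); set L' := ln (2 * n + 2).
have L2 : ln 2 <= L by rewrite ler_ln ?posrE; lra.
have LL : L <= L' by rewrite ler_ln ?posrE; lra.
have L4 : 2 * ln 2 <= L'.
  have -> : 2 * ln 2 = ln (2 * 2) :> R by rewrite lnM ?posrE //; ring.
  by rewrite ler_ln ?posrE; lra.
have D2 := truncnS_gt (36 * L ^+ 2); set D := (Num.truncn _).+1 in D2.
have L0 : 0 <= 36 * L ^+ 2 by rewrite mulr_ge0 // sqr_ge0.
have D3 : D%:R <= 36 * L ^+ 2 + 1.
  by rewrite /D -natr1 lerD2r; have /andP[] := truncn_itv L0.
exists (4 * D)%N; split; first exact: box_map.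
rewrite natrM; have := C0_ge161; have := ln2_ge_half.
move: D3 L2 LL L4; clearbody L L'; move: (C0 R) (ln 2) (D%:R) => C l d.
move=> D3 L2 LL L4 l2 C161.
have LL' : L ^+ 2 <= L * L' by rewrite expr2 ler_wpM2l //; lra.
have half : 1 / 2 <= L * L' by rewrite -[1 / 2]mulr1 ler_pM //; lra.
have : 161 * (L * L') <= C * (L * L') by rewrite ler_wpM2r //; lra.
rewrite -mulrA; move: (L * L') (C * _) LL' half => p q; lra.
Qed.

Lemma Z2index_box (G : sgraph) : triangle_free G -> (1 <= #|G|)%N ->
  (Z2index R (box_space G R) <=
    (C0 R * ln (2 * #|G|%:R) * ln (2 * #|G|%:R + 2))%:E)%E.
Proof.
move=> tf n1; have [k [Hk kC]] := box_index_bound tf n1.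
rewrite /Z2index; case: ifP => _.
  by rewrite lee_fin; apply: le_trans (_ : 0 <= _); [lra|exact: le_trans kC].
apply: (@le_trans _ _ (k%:R%:E)); last by rewrite lee_fin.
by apply: ereal_inf_lbound; exists k.
Qed.

End index_bound.

(** * Tucker's lemma on the cubical grid *)

Lemma can_leq_card (T T' : finType) (A : pred T) (B : pred T') g h :
  (forall x, A x -> B (g x)) -> (forall x, A x -> h (g x) = x) ->
  (#|A| <= #|B|)%N.
Proof.
move=> gAB ghK.
have gi : {in A &, injective g} by move=> x y /ghK {2}<- /ghK {2}<- ->.
rewrite -(card_in_image gi); apply: subset_leq_card.
by apply/fintype.subsetP => y /mapP[x]; rewrite mem_enum => Ax ->; exact: gAB.
Qed.

Lemma can_eq_card (T T' : finType) (A : pred T) (B : pred T') g h :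
  (forall x, A x -> B (g x)) -> (forall x, A x -> h (g x) = x) ->
  (forall y, B y -> A (h y)) -> (forall y, B y -> g (h y) = y) ->
  #|A| = #|B|.
Proof.
move=> gAB ghK hBA hgK; apply/eqP.
by rewrite eqn_leq (can_leq_card gAB ghK) (can_leq_card hBA hgK).
Qed.

Section parity.
Variable T : finType.

Lemma odd_card_involution (A : pred T) (g : T -> T) :
  (forall x, A x -> A (g x)) -> (forall x, A x -> g (g x) = x) ->
  (forall x, A x -> g x != x) -> odd #|A| = false.
Proof.
move=> gA gK gx.
pose lo := [pred x | A x && (enum_rank x < enum_rank (g x))%N].
pose hi := [pred x | A x && (enum_rank (g x) < enum_rank x)%N].
have -> : #|A| = (#|lo| + #|hi|)%N.
  rewrite -(cardID lo A) -[RHS]/(#|lo| + #|hi|)%N.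
  congr addn; apply: eq_card => x; rewrite !inE /= -?topredE /=.
    by rewrite andbA andbb.
  case Ax: (A x); rewrite ?andbF //= andbT.
  case: ltngtP => // e; case/eqP: (gx _ Ax).
  by apply: enum_rank_inj; exact: ord_inj.
have -> : #|lo| = #|hi|.
  apply: (can_eq_card (g := g) (h := g)) => x /= /andP[Ax xg]; rewrite ?gA ?gK //.
by rewrite oddD addbb.
Qed.

End parity.

Section kuhn.
Variables (m N : nat).

Definition dir : finType := ('I_m * bool)%type.
Definition flip (e : dir) : dir := (e.1, ~~ e.2).

Lemma flipK : involutive flip. Proof. by case=> j s; rewrite /flip /= negbK. Qed.

Implicit Types (v : {ffun 'I_m -> 'I_N.+1}) (t : seq dir).

(** A pair [(v, t)] encodes a simplex of the Kuhn triangulation of the orthant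
    spanned by the signed directions of [t]: start at the point with absolute
    coordinates [v] and move away from the origin along the directions of [t],
    one after the other. All orthants of all dimensions are considered
    together. *)
Definition height v t l j : nat := (v j + (j \in unzip1 (take l t)))%N.

Definition lattice_point v t l : 'I_m -> int := fun j =>
  if (j, true) \in t then (height v t l j)%:Z else - (height v t l j)%:Z.

Definition cell v t : bool :=
  uniq (unzip1 t) && [forall j, (j \notin unzip1 t) ==> (v j == ord0)].

Lemma cell_uniq v t : cell v t -> uniq t.
Proof. by move=> /andP[/map_uniq]. Qed.

Lemma cell_size v t : cell v t -> (size t <= m)%N.
Proof.
move=> /andP[ut _]; rewrite -(size_map fst t) -(card_uniqP ut).
by apply: leq_trans (max_card _) _; rewrite card_ord.
Qed.

Lemma uniq_map_inj (T1 T2 : eqType) (f : T1 -> T2) (s : seq T1) :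
  uniq (map f s) -> {in s &, injective f}.
Proof.
elim: s => // a s IH /= /andP[fa us] x y; rewrite !inE.
move=> /predU1P[->|xs] /predU1P[->|ys] // e; last exact: IH.
  by case/negP: fa; rewrite e map_f.
by case/negP: fa; rewrite -e map_f.
Qed.

Lemma flip_mem t e : e.1 \in unzip1 t -> e \notin t -> flip e \in t.
Proof.
move=> /mapP[[j s] jt /= e1]; case: e e1 => k s' /= ->.
by case: s jt; case: s' => jt; rewrite ?jt /flip //= jt.
Qed.

Lemma cell_flip v t e : cell v t -> e \in t -> flip e \notin t.
Proof.
move=> /andP[ut _] et; apply/negP => ft.
have := uniq_map_inj ut et ft erefl; case: e {et ft} => j s [].
by case: s.
Qed.

Lemma cell_point v t l j : cell v t -> j \notin unzip1 t -> lattice_point v t l j = 0.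
Proof.
move=> /andP[_ /forallP/(_ j)/implyP v0] jt; rewrite /lattice_point /height.
have -> : (j \in unzip1 (take l t)) = false.
  by apply: contraNF jt; rewrite /unzip1 map_take; exact: mem_take.
by rewrite (eqP (v0 jt)); case: ifP.
Qed.

Lemma eq_point v t t' l l' : {subset t <= t'} -> {subset t' <= t} ->
  unzip1 (take l t) =i unzip1 (take l' t') -> lattice_point v t l = lattice_point v t' l'.
Proof.
move=> tt' t't E; apply/funext => j; rewrite /lattice_point /height E.
by rewrite (_ : ((j, true) \in t) = ((j, true) \in t')) //; apply/idP/idP; [exact: tt'|exact: t't].
Qed.

Section labelling.
Variable lam : ('I_m -> int) -> dir.

Definition label v t l : dir := lam (lattice_point v t l).

Definition others i d := [seq j <- iota 0 d.+1 | j != i].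

Definition facet v t i : seq dir := [seq label v t l | l <- others i (size t)].

(** Doors are what the parity argument counts. A cell whose labels include all
    its directions has one or two doors, and a facet separates two cells of
    its orthant unless it lies on a coordinate hyperplane or on the boundary
    of the cube. *)
Definition door v t i : bool :=
  [&& cell v t, (i <= size t)%N & perm_eq (facet v t i) t].

Lemma mem_others i d j : (j \in others i d) = (j != i) && (j <= d)%N.
Proof. by rewrite mem_filter mem_iota. Qed.

Lemma perm_others i d : (i <= d)%N -> perm_eq (iota 0 d.+1) (i :: others i d).
Proof.
move=> id; have ii : i \in iota 0 d.+1 by rewrite mem_iota.
by rewrite (perm_trans (perm_to_rem ii)) // rem_filter ?iota_uniq.
Qed.

Lemma others_last d : others d d = iota 0 d.
Proof.
rewrite /others -addn1 iotaD filter_cat /= add0n eqxx cats0.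
by apply/all_filterP/allP => j; rewrite mem_iota => /andP[_ /ltn_eqF ->].
Qed.

Lemma others_first d : others 0 d = iota 1 d.
Proof.
by rewrite /others /=; apply/all_filterP/allP => j; rewrite mem_iota; case: j.
Qed.

Lemma perm_facet v t i : (i <= size t)%N ->
  perm_eq [seq label v t l | l <- iota 0 (size t).+1] (label v t i :: facet v t i).
Proof. by move=> it; rewrite (perm_map _ (perm_others it)). Qed.

Lemma door_cell v t i : door v t i -> cell v t.
Proof. by case/and3P. Qed.

Lemma door_inj v t i j j' : door v t i -> (j <= size t)%N -> (j' <= size t)%N ->
  j != i -> j' != i -> label v t j = label v t j' -> j = j'.
Proof.
move=> /and3P[/cell_uniq ut it pe] jt j't ji j'i.
by apply: (@uniq_map_inj _ _ (label v t) (others i (size t)));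
  rewrite ?mem_others ?ji ?j'i // -/(facet v t i) (perm_uniq pe).
Qed.

Lemma door_surj v t i e : door v t i -> e \in t ->
  exists j, [/\ (j <= size t)%N, j != i & label v t j = e].
Proof.
move=> /and3P[_ _ pe]; rewrite -(perm_mem pe) => /mapP[j].
by rewrite mem_others => /andP[ji jt] ->; exists j.
Qed.

Lemma door_twin v t i j : door v t i -> (j <= size t)%N ->
  label v t j = label v t i -> door v t j.
Proof.
move=> /and3P[ct it pe] jt ji; rewrite /door ct jt /=.
apply: perm_trans pe; rewrite -(perm_cons (label v t j)).
rewrite {2}ji; apply: perm_trans (perm_facet v it).
by rewrite perm_sym; exact: perm_facet.
Qed.

(** Sequences of bounded length make the possible doors a finite type, and by
    [cell_size] the bound excludes no cell. *)
Definition code : finType := ({ffun 'I_m -> 'I_N.+1} * m.-bseq dir * 'I_m.+1)%type.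
Definition code_of v t (i : nat) : code := (v, insub_bseq m t, inord i).

Lemma val_code v t : cell v t -> val (insub_bseq m t) = t.
Proof. by move=> ct; rewrite insubdK // unfold_in; exact: cell_size ct. Qed.

Definition is_door (x : code) : bool := door x.1.1 (val x.1.2) x.2.

Lemma code_ofK (x : code) : code_of x.1.1 (val x.1.2) x.2 = x.
Proof.
case: x => [[v t] i]; rewrite /code_of /= inord_val; congr (_, _, _).
exact: valKd.
Qed.

Definition twin_code (x : code) : code :=
  (x.1, odflt x.2 [pick j : 'I_m.+1 | [&& (j <= size (val x.1.2))%N, j != x.2 &
     label x.1.1 (val x.1.2) j == label x.1.1 (val x.1.2) x.2]]).

Definition repeated_door (x : code) : bool :=
  is_door x && (label x.1.1 (val x.1.2) x.2 \in val x.1.2).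

Lemma twin_codeP x : repeated_door x -> exists j : 'I_m.+1,
  [/\ twin_code x = (x.1, j), (j <= size (val x.1.2))%N, j != x.2
    & label x.1.1 (val x.1.2) j = label x.1.1 (val x.1.2) x.2].
Proof.
case/andP => dx /(door_surj dx) [j [jt ji jl]]; rewrite /twin_code.
case: pickP => [k /and3P[kt ki /eqP kl]|/(_ (inord j))]; first by exists k.
have jm : (j < m.+1)%N by rewrite ltnS (leq_trans jt) // (cell_size (door_cell dx)).
by rewrite -val_eqE /= inordK // jt ji jl eqxx.
Qed.

(** If the label opposite to a door is a direction of the cell, exactly one other
    vertex carries it, and the facet opposite to that vertex is the second
    door of the cell. *)
Lemma odd_repeated_door : odd #|repeated_door| = false.
Proof.
apply: (@odd_card_involution _ _ twin_code) => x rx; have [j [-> jt ji jl]] := twin_codeP rx.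
- case/andP: rx => dx lx; rewrite /repeated_door /is_door /= jl lx andbT.
  exact: (door_twin dx jt jl).
- have dj : door x.1.1 (val x.1.2) j by case/andP: rx => dx _; exact: (door_twin dx jt jl).
  have rj : repeated_door (x.1, j) by rewrite /repeated_door /is_door /= dj jl; case/andP: rx.
  have [k /= [-> kt kj kl]] := twin_codeP rj.
  case/andP: rx => dx lx; case: x dx lx jt ji jl dj rj kt kj kl => [[v t] i] /= dx lx.
  move=> jt ji jl dj rj kt kj kl; congr (_, _); apply: ord_inj.
  apply: (door_inj dj) => //; last by rewrite kl.
    by case/and3P: dx.
  by rewrite eq_sym.
by case: x {rx jt jl} ji => [[v t] i] /= ji; rewrite xpair_eqE eqxx.
Qed.

Definition swap_at i t : seq dir :=
  take i.-1 t ++ (if drop i.-1 t is x :: y :: c then y :: x :: c else drop i.-1 t).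

Lemma swap_atE (a c : seq dir) x y :
  swap_at (size a).+1 (a ++ x :: y :: c) = a ++ y :: x :: c.
Proof. by rewrite /swap_at /= take_size_cat // drop_size_cat. Qed.

Lemma split_at i t : (0 < i < size t)%N ->
  exists a x y c, t = a ++ x :: y :: c /\ i = (size a).+1.
Proof.
case: i => // i /andP[_ it].
case: t it => // x0 t' it; set t := x0 :: t' in it *.
exists (take i t), (nth x0 t i), (nth x0 t i.+1), (drop i.+2 t); split.
  by rewrite -!drop_nth ?cat_take_drop // ltnW.
by rewrite size_takel // ltnW // ltnW.
Qed.

Lemma perm_swap_at (a c : seq dir) x y : perm_eq (a ++ y :: x :: c) (a ++ x :: y :: c).
Proof. by rewrite perm_cat2l; apply/permPl; exact: (perm_catCA [:: y] [:: x] c). Qed.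

Lemma cell_perm v t t' : perm_eq t' t -> cell v t -> cell v t'.
Proof.
move=> pt /andP[ut /forallP v0]; apply/andP; split.
  by rewrite (perm_uniq (perm_map _ pt)).
by apply/forallP => j; rewrite (perm_mem (perm_map _ pt)); exact: v0.
Qed.

Lemma label_swap v (a c : seq dir) x y l : l != (size a).+1 ->
  label v (a ++ y :: x :: c) l = label v (a ++ x :: y :: c) l.
Proof.
move=> la; congr lam; apply: eq_point.
- by move=> z; rewrite (perm_mem (perm_swap_at a c x y)).
- by move=> z; rewrite (perm_mem (perm_swap_at a c x y)).
move=> j; rewrite !take_cat; case: ltnP => // al.
case E: (l - size a)%N => [|[|k]] //=.
  by move: la; rewrite -[l](subnK al) E add1n eqxx.
by rewrite /unzip1 !map_cat !mem_cat /= !inE; congr orb; exact: orbCA.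
Qed.

Lemma door_swap v (a c : seq dir) x y (i := (size a).+1) :
  door v (a ++ x :: y :: c) i -> door v (a ++ y :: x :: c) i.
Proof.
move=> /and3P[ct it pe]; have ps := perm_swap_at a c x y.
rewrite /door (cell_perm ps ct) (perm_size ps) it /=.
have -> : facet v (a ++ y :: x :: c) i = facet v (a ++ x :: y :: c) i.
  rewrite /facet (perm_size ps); apply/eq_in_map => l.
  by rewrite mem_others => /andP[li _]; rewrite label_swap.
by apply: perm_trans pe _; rewrite perm_sym.
Qed.

Definition swap_code (x : code) : code :=
  code_of x.1.1 (swap_at x.2 (val x.1.2)) x.2.

Definition inner_door (x : code) : bool :=
  is_door x && (0 < x.2 < size (val x.1.2))%N.

(** Exchanging two consecutive directions of a path moves only the vertex
    between them, so the door opposite to this vertex belongs to both cells. *)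
Lemma odd_inner_door : odd #|inner_door| = false.
Proof.
have H x : inner_door x -> exists a e f c,
    [/\ val x.1.2 = a ++ e :: f :: c, (x.2 : nat) = (size a).+1, e != f &
      [/\ cell x.1.1 (a ++ f :: e :: c), door x.1.1 (a ++ f :: e :: c) x.2
       & swap_code x = code_of x.1.1 (a ++ f :: e :: c) x.2]].
  case/andP => dx /split_at [a [e [f [c [tE iE]]]]]; exists a, e, f, c.
  move: dx; rewrite /is_door /swap_code tE iE => dx.
  have := cell_uniq (door_cell dx); rewrite cat_uniq.
  case/and3P=> _ _ /= /andP[]; rewrite inE negb_or => /andP[-> _] _.
  split=> //; have dy := door_swap dx.
  by rewrite swap_atE (door_cell dy).
apply: (@odd_card_involution _ _ swap_code) => x /H [a [e [f [c [tE iE ef [cy dy ->]]]]]].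
- by rewrite /inner_door /is_door /code_of /= (val_code cy) inord_val dy iE /= size_cat /=; lia.
- rewrite -[RHS]code_ofK /swap_code /code_of /= (val_code cy) inord_val.
  by congr (_, _, _); [rewrite iE swap_atE tE|exact: inord_val].
apply/eqP => /(congr1 (fun x => val x.1.2)); rewrite /code_of /= (val_code cy) tE.
by move=> /eqP; rewrite eqseq_cat // eqxx /= eqseq_cons eq_sym (negbTE ef).
Qed.

Lemma rot_label v v' t e l : cell v (e :: t) ->
  (forall j, v' j = (v j + (j == e.1))%N :> nat) -> (l <= size t)%N ->
  label v' (rcons t e) l = label v (e :: t) l.+1.
Proof.
move=> /andP[/= /andP[et _] _] v'E lt; congr lam; apply/funext => j.
have hE : height v' (rcons t e) l j = height v (e :: t) l.+1 j.
  rewrite /height /= -cats1 takel_cat // v'E inE -addnA; congr addn.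
  case: eqP => //= ->; rewrite (_ : (e.1 \in _) = false) //.
  by apply: contraNF et; rewrite /unzip1 map_take; exact: mem_take.
by rewrite /lattice_point hE mem_rcons.
Qed.

Lemma cell_rot v v' t e : 
  (forall j, v' j = (v j + (j == e.1))%N :> nat) ->
  cell v' (rcons t e) = cell v (e :: t).
Proof.
move=> v'E; rewrite /cell /unzip1 map_rcons rcons_uniq /=; congr andb.
apply: eq_forallb => j; rewrite mem_rcons inE negb_or.
have := v'E j; case: eqP => //= _; rewrite addn0 => vv.
by rewrite -!val_eqE /= vv.
Qed.

(** A path without its first vertex is the path that starts one step later and
    makes the first step at the end, without its last vertex. *)
Lemma door_rot v v' t e : 
  (forall j, v' j = (v j + (j == e.1))%N :> nat) ->
  door v' (rcons t e) (size t).+1 = door v (e :: t) 0.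
Proof.
move=> v'E; rewrite /door (cell_rot _ v'E) size_rcons leqnn /=.
case ct: (cell v (e :: t)) => //=.
rewrite (_ : facet _ _ _ = facet v (e :: t) 0).
  by rewrite perm_sym perm_rcons perm_sym.
rewrite /facet size_rcons [size (_ :: _)]/= others_last others_first (iotaDl 1 0) -map_comp.
by apply/eq_in_map => l; rewrite mem_iota ltnS => /= lt; rewrite (rot_label ct).
Qed.

Definition incr_at v (j0 : 'I_m) : {ffun 'I_m -> 'I_N.+1} :=
  [ffun j => if j == j0 then inord (v j).+1 else v j].
Definition decr_at v (j0 : 'I_m) : {ffun 'I_m -> 'I_N.+1} :=
  [ffun j => if j == j0 then inord (v j).-1 else v j].

Lemma incr_atE v j0 : (v j0 < N)%N -> forall j, incr_at v j0 j = (v j + (j == j0))%N :> nat.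
Proof.
move=> vN j; rewrite ffunE; case: eqP => [->|_]; last by rewrite addn0.
by rewrite inordK ?addn1.
Qed.

Lemma decr_atE v j0 : (v j0 != ord0) -> forall j, v j = (decr_at v j0 j + (j == j0))%N :> nat.
Proof.
move=> vN j; rewrite ffunE; case: eqP => [->|_]; last by rewrite addn0.
rewrite inordK; last by apply: leq_ltn_trans (leq_pred _) _.
by rewrite addn1 prednK // lt0n.
Qed.

Lemma incr_atK v j0 : (v j0 < N)%N -> decr_at (incr_at v j0) j0 = v.
Proof.
move=> vN; apply/ffunP => j; rewrite !ffunE; case: eqP => // ->.
have E : (inord (v j0).+1 : 'I_N.+1) = (v j0).+1 :> nat by rewrite inordK.
by rewrite E /= inord_val.
Qed.

Lemma decr_atK v j0 : (v j0 != ord0) -> incr_at (decr_at v j0) j0 = v.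
Proof.
move=> vN; apply/ffunP => j; rewrite !ffunE; case: eqP => // ->.
have v0 : (0 < v j0)%N by rewrite lt0n.
have vp : ((v j0).-1 < N.+1)%N by apply: leq_ltn_trans (leq_pred _) _.
have E : (inord (v j0).-1 : 'I_N.+1) = (v j0).-1 :> nat by rewrite inordK.
by rewrite E prednK // inord_val.
Qed.

Lemma last_split t e : (drop (size (rcons t e)).-1 (rcons t e) = [:: e]) *
  (take (size (rcons t e)).-1 (rcons t e) = t).
Proof. by rewrite size_rcons -cats1 drop_size_cat // take_size_cat. Qed.

Definition on_first (P : {ffun 'I_m -> 'I_N.+1} -> dir -> bool) (x : code) : bool :=
  [&& is_door x, x.2 == ord0 & if val x.1.2 is e :: _ then P x.1.1 e else false].

Definition on_last (P : {ffun 'I_m -> 'I_N.+1} -> dir -> bool) (x : code) : bool :=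
  [&& is_door x, val x.2 == size (val x.1.2) &
   if drop (size (val x.1.2)).-1 (val x.1.2) is e :: _ then P x.1.1 e else false].

Lemma on_firstP P x : on_first P x -> exists e t,
  [/\ door x.1.1 (e :: t) 0, P x.1.1 e, val x.1.2 = e :: t & x.2 = ord0].
Proof.
case: x => [[v t] i] /and3P[/= + /eqP i0]; rewrite /is_door /= i0.
by case: (val t) => // e s ds Pe; exists e, s.
Qed.

Lemma on_lastP P x : on_last P x -> exists e t,
  [/\ door x.1.1 (rcons t e) (size t).+1, P x.1.1 e, val x.1.2 = rcons t e
    & val x.2 = (size t).+1].
Proof.
case: x => [[v t] i] /and3P[/= + /eqP i0]; rewrite /is_door /= i0.
case/lastP: (val t) => // s e; rewrite last_split size_rcons => ds Pe.
by exists e, s.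
Qed.

Lemma on_first_code (P : {ffun 'I_m -> 'I_N.+1} -> dir -> bool) v t e :
  door v (e :: t) 0 -> P v e ->
  on_first P (code_of v (e :: t) 0).
Proof.
move=> dt Pe; rewrite /on_first /is_door /code_of /= (val_code (door_cell dt)).
by rewrite inordK // dt Pe -val_eqE /= inordK.
Qed.

Lemma on_last_code (P : {ffun 'I_m -> 'I_N.+1} -> dir -> bool) v t e :
  door v (rcons t e) (size t).+1 -> P v e ->
  on_last P (code_of v (rcons t e) (size t).+1).
Proof.
move=> dt Pe; rewrite /on_last /is_door /code_of /= (val_code (door_cell dt)).
have st := cell_size (door_cell dt); rewrite size_rcons in st.
by rewrite inordK // dt last_split size_rcons eqxx Pe.
Qed.

Definition rot_up (x : code) : code :=
  if val x.1.2 is e :: t then code_of (incr_at x.1.1 e.1) (rcons t e) (size t).+1 else x.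
Definition rot_down (x : code) : code :=
  let t := val x.1.2 in
  if drop (size t).-1 t is e :: _ then
    code_of (decr_at x.1.1 e.1) (e :: take (size t).-1 t) 0 else x.

Lemma rot_up_code v t e i : cell v (e :: t) ->
  rot_up (code_of v (e :: t) i) = code_of (incr_at v e.1) (rcons t e) (size t).+1.
Proof. by move=> ct; rewrite /rot_up /= (val_code ct). Qed.

Lemma rot_down_code v t e i : cell v (rcons t e) ->
  rot_down (code_of v (rcons t e) i) = code_of (decr_at v e.1) (e :: t) 0.
Proof. by move=> ct; rewrite /rot_down /= (val_code ct) !last_split. Qed.

Lemma code_eq x t i : val x.1.2 = t -> val x.2 = i -> x = code_of x.1.1 t i.
Proof. by move=> <- <-; rewrite code_ofK. Qed.

Lemma card_rot : #|on_first (fun v e => v e.1 < N)%N| =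
  #|on_last (fun v e => v e.1 != ord0)|.
Proof.
have first_last x : on_first (fun v e => v e.1 < N)%N x ->
    exists e t v, [/\ x = code_of v (e :: t) 0, door v (e :: t) 0, (v e.1 < N)%N
      & door (incr_at v e.1) (rcons t e) (size t).+1].
  case/on_firstP => e [t [dt vN tE iE]]; exists e, t, x.1.1; split=> //.
    by apply: code_eq => //; rewrite iE.
  by rewrite (door_rot _ (incr_atE vN)).
have last_first x : on_last (fun v e => v e.1 != ord0) x ->
    exists e t v, [/\ x = code_of v (rcons t e) (size t).+1,
      door v (rcons t e) (size t).+1, v e.1 != ord0
      & door (decr_at v e.1) (e :: t) 0].
  case/on_lastP => e [t [dt v0 tE iE]]; exists e, t, x.1.1; split=> //.
    exact: code_eq.
  by rewrite -(door_rot _ (decr_atE v0)).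
apply: (can_eq_card (g := rot_up) (h := rot_down)).
- move=> _ /first_last [e [t [v [-> dv vN du]]]].
  rewrite rot_up_code ?(door_cell dv) //; apply: on_last_code => //.
  by rewrite -val_eqE /= incr_atE // eqxx addn1.
- move=> _ /first_last [e [t [v [-> dv vN du]]]].
  rewrite rot_up_code ?(door_cell dv) // rot_down_code ?(door_cell du) //.
  by rewrite incr_atK.
- move=> _ /last_first [e [t [v [-> dv v0 du]]]].
  rewrite rot_down_code ?(door_cell dv) //; apply: on_first_code => //.
  have := decr_atE v0 e.1; rewrite eqxx addn1 => vE.
  by rewrite -ltnS -vE.
move=> _ /last_first [e [t [v [-> dv v0 du]]]].
rewrite rot_down_code ?(door_cell dv) // rot_up_code ?(door_cell du) //.
by rewrite decr_atK.
Qed.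


Lemma height_le v t l j : (height v t l j <= N.+1)%N.
Proof.
rewrite /height; have := ltn_ord (v j); rewrite ltnS => vj.
by apply: leq_trans (leq_add vj (leq_b1 _)) _; rewrite addn1.
Qed.

Lemma abs_point v t l j : absz (lattice_point v t l j) = height v t l j.
Proof. by rewrite /lattice_point; case: ifP => _ //; rewrite abszN. Qed.

Lemma point_close v t l l' j : (absz (lattice_point v t l j - lattice_point v t l' j) <= 1)%N.
Proof.
rewrite /lattice_point /height; case: ifP => _; move: (_ \in _) (_ \in _) => [] [];
  rewrite ?addn0 ?addn1; lia.
Qed.

Hypothesis no_complementary : forall p q : 'I_m -> int,
  (forall j, absz (p j) <= N.+1)%N -> (forall j, absz (q j) <= N.+1)%N ->
  (forall j, absz (p j - q j) <= 1)%N -> lam q != flip (lam p).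

Lemma label_flip v t l l' : label v t l != flip (label v t l').
Proof.
apply: no_complementary => j; rewrite ?abs_point ?height_le //.
exact: point_close.
Qed.

Definition fresh_door (x : code) : bool :=
  is_door x && (label x.1.1 (val x.1.2) x.2 \notin val x.1.2).

(** A label on an axis of the cell, but not among its directions, would be
    opposite to a direction, and every direction is a label. *)
Lemma fresh_coord v t i : door v t i -> label v t i \notin t ->
  (label v t i).1 \notin unzip1 t.
Proof.
move=> dt lt; apply/negP => /flip_mem/(_ lt) ft.
have [j [_ _ jE]] := door_surj dt ft.
by have := label_flip v t j i; rewrite jE eqxx.
Qed.

Lemma label_rcons v t e l : cell v t -> e.1 \notin unzip1 t -> (l <= size t)%N ->
  label v (rcons t e) l = label v t l.
Proof.
move=> ct et lt; congr lam; apply/funext => j.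
have hE : height v (rcons t e) l j = height v t l j.
  by rewrite /height -cats1 takel_cat.
have [je|je] := eqVneq j e.1.
  have h0 : height v t l j = 0%N by rewrite -abs_point cell_point ?je.
  by rewrite /lattice_point hE h0; do 2 case: ifP.
rewrite /lattice_point hE mem_rcons inE (_ : ((j, true) == e) = false) //.
by case: e je {et hE} => k s /= jk; rewrite xpair_eqE (negbTE jk).
Qed.

Lemma cell_rcons v t e : cell v t -> e.1 \notin unzip1 t -> cell v (rcons t e).
Proof.
move=> /andP[ut /forallP v0] et; rewrite /cell /unzip1 map_rcons rcons_uniq et ut /=.
apply/forallP => j; rewrite mem_rcons inE negb_or; apply/implyP => /andP[_ jt].
exact: (implyP (v0 j)).
Qed.

Lemma cell_unrcons v t e : cell v (rcons t e) -> v e.1 == ord0 ->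
  cell v t /\ e.1 \notin unzip1 t.
Proof.
rewrite /cell /unzip1 map_rcons rcons_uniq => /andP[/andP[et ut] /forallP v0] ve.
split=> //; rewrite ut /=; apply/forallP => j; apply/implyP => jt.
have [->//|je] := eqVneq j e.1.
by apply: (implyP (v0 j)); rewrite mem_rcons inE negb_or je.
Qed.

Definition lower_door : pred code := on_last (fun v e => v e.1 == ord0).

Definition all_labels v t : seq dir := [seq label v t l | l <- iota 0 (size t).+1].

Lemma nth_all_labels v t x0 l : (l <= size t)%N -> nth x0 (all_labels v t) l = label v t l.
Proof.
by move=> lt; rewrite (nth_map 0%N) ?size_iota ?ltnS // nth_iota.
Qed.

Lemma size_all_labels v t : size (all_labels v t) = (size t).+1.
Proof. by rewrite size_map size_iota. Qed.

Lemma facet_rcons v t e : cell v t -> e.1 \notin unzip1 t ->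
  facet v (rcons t e) (size t).+1 = all_labels v t.
Proof.
move=> ct et; rewrite /facet size_rcons others_last; apply/eq_in_map => l.
by rewrite mem_iota ltnS => /= lt; rewrite label_rcons.
Qed.

Definition extend_code (x : code) : code :=
  let t := val x.1.2 in
  code_of x.1.1 (rcons t (label x.1.1 t x.2)) (size t).+1.

Definition cut_code (x : code) : code :=
  let t := val x.1.2 in
  if drop (size t).-1 t is e :: _ then
    let t1 := take (size t).-1 t in code_of x.1.1 t1 (index e (all_labels x.1.1 t1))
  else x.

Lemma cut_codeE v t e i : cell v (rcons t e) ->
  cut_code (code_of v (rcons t e) i) = code_of v t (index e (all_labels v t)).
Proof. by move=> ct; rewrite /cut_code /= (val_code ct) !last_split. Qed.

(** A cell whose vertices carry all its directions and one further label is
    the lower facet of the cell obtained by appending that label. *)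
Lemma card_fresh_door : #|fresh_door| = #|lower_door|.
Proof.
have extP x : fresh_door x -> exists t i e, [/\ x = code_of x.1.1 t i,
    cell x.1.1 t, label x.1.1 t i = e,
    extend_code x = code_of x.1.1 (rcons t e) (size t).+1
    & [/\ door x.1.1 (rcons t e) (size t).+1, x.1.1 e.1 == ord0
      & index e (all_labels x.1.1 t) = i]].
  move=> /andP[dx lx]; exists (val x.1.2), x.2, (label x.1.1 (val x.1.2) x.2).
  rewrite code_ofK (door_cell dx); split=> //.
  have ex := fresh_coord dx lx; have cx := cell_rcons (door_cell dx) ex.
  have /and3P[ct it pe] := dx; have pl := perm_facet x.1.1 it.
  set e := label _ _ _ in lx ex cx pl *; set t := val x.1.2 in lx ex cx ct it pe pl *.
  have ps : perm_eq (all_labels x.1.1 t) (e :: t).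
    by apply: (perm_trans pl); rewrite perm_cons.
  split.
  - rewrite /door cx size_rcons leqnn facet_rcons //=.
    by rewrite perm_sym perm_rcons perm_sym.
  - by case/andP: ct => _ /forallP/(_ e.1)/implyP; apply.
  rewrite /e -(nth_all_labels _ e) // index_uniq ?size_all_labels //.
  by rewrite (perm_uniq ps) /= lx (cell_uniq ct).
have cutP x : lower_door x -> exists t e, let i := index e (all_labels x.1.1 t) in
    [/\ x = code_of x.1.1 (rcons t e) (size t).+1, cell x.1.1 (rcons t e),
      cut_code x = code_of x.1.1 t i, door x.1.1 t i
    & label x.1.1 t i = e /\ e \notin t].
  case/on_lastP => e [t [dt v0 tE iE]]; exists t, e => i.
  have [ct et] := cell_unrcons (door_cell dt) v0.
  have /and3P[ctr _ ] := dt; rewrite facet_rcons // => pe.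
  have ex : e \in all_labels x.1.1 t by rewrite (perm_mem pe) mem_rcons mem_head.
  have it : (i <= size t)%N by rewrite -ltnS -(size_all_labels x.1.1) index_mem.
  have ie : label x.1.1 t i = e by rewrite -(nth_all_labels _ e) // nth_index.
  have etn : e \notin t by apply: contra et => et; exact: map_f.
  split=> //.
  - exact: code_eq.
  - by rewrite /cut_code tE !last_split.
  rewrite /door ct it /= -(perm_cons e) -{1}ie -(permPl (perm_facet x.1.1 it)).
  by rewrite (permPl pe) perm_rcons.
apply: (can_eq_card (g := extend_code) (h := cut_code)).
- move=> x /extP [t [i [e [_ _ _ -> [dt ve _]]]]].
  exact: on_last_code.
- move=> x /extP [t [i [e [xE ct _ -> [dt _ iE]]]]].
  by rewrite cut_codeE ?(door_cell dt) // iE -xE.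
- move=> x /cutP [t [e [_ _ -> dt [le et]]]].
  rewrite /fresh_door /is_door /= (val_code (door_cell dt)).
  rewrite inordK ?dt ?le //; case/and3P: dt => ct it _.
  by rewrite ltnS (leq_trans it) // (cell_size ct).
move=> x /cutP [t [e [xE ctr -> dt [le et]]]].
rewrite /extend_code /= (val_code (door_cell dt)).
rewrite inordK ?le //; case/and3P: dt => ct it _.
by rewrite ltnS (leq_trans it) // (cell_size ct).
Qed.

Hypothesis antipodal : forall p : 'I_m -> int,
  (forall j, absz (p j) <= N.+1)%N -> (exists j, absz (p j) = N.+1) ->
  lam (fun j => - p j) = flip (lam p).

Lemma flip_inj : injective flip. Proof. exact: can_inj flipK. Qed.

Lemma unzip1_flip t : unzip1 (map flip t) = unzip1 t.
Proof. by rewrite /unzip1 -map_comp. Qed.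

Lemma cell_map_flip v t : cell v (map flip t) = cell v t.
Proof. by rewrite /cell unzip1_flip. Qed.

Lemma point_flip v t l : cell v t ->
  lattice_point v (map flip t) l = fun j => - lattice_point v t l j.
Proof.
move=> ct; apply/funext => j.
have [jt|jt] := boolP (j \in unzip1 t); last first.
  by rewrite !cell_point ?oppr0 ?cell_map_flip ?unzip1_flip.
have hE : height v (map flip t) l j = height v t l j.
  by rewrite /height -map_take unzip1_flip.
rewrite /lattice_point hE -[(j, true)](flipK (j, true)) (mem_map flip_inj) flipK.
have [t1|t0] := boolP ((j, true) \in t).
  by rewrite (negbTE (cell_flip ct t1)).
by rewrite (@flip_mem t (j, true) jt t0) opprK.
Qed.

Definition outer_door : pred code := on_first (fun v e => val (v e.1) == N).

Definition antipode_code (x : code) : code := code_of x.1.1 (map flip (val x.1.2)) 0.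

Lemma door_antipode v t e : door v (e :: t) 0 -> val (v e.1) = N ->
  door v (map flip (e :: t)) 0.
Proof.
move=> /and3P[ct _ pe] vN; rewrite /door cell_map_flip ct; apply/and3P; split=> //.
rewrite (_ : facet v _ 0 = map flip (facet v (e :: t) 0)); first exact: (perm_map flip pe).
rewrite /facet size_map -map_comp; apply/eq_in_map => l.
rewrite mem_others => /andP[l0 _].
rewrite -[RHS]/(flip (label v (e :: t) l)) /label point_flip //.
apply: antipodal => [j|]; first by rewrite abs_point height_le.
exists e.1; rewrite abs_point /height; case: l l0 => // l _.
by rewrite /= inE eqxx addn1 vN.
Qed.

(** Outer doors lie on the boundary of the cube, where the labelling is odd;
    reflection in the origin pairs them without fixed points. *)
Lemma odd_outer_door : odd #|outer_door| = false.
Proof.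
have H x : outer_door x -> exists e t, [/\ x = code_of x.1.1 (e :: t) 0,
    val x.1.2 = e :: t, val (x.1.1 e.1) = N, door x.1.1 (map flip (e :: t)) 0
    & antipode_code x = code_of x.1.1 (map flip (e :: t)) 0].
  case/on_firstP => e [t [dt /eqP vN tE iE]]; exists e, t; split=> //.
  - by apply: code_eq => //; rewrite iE.
  - exact: door_antipode.
  - by rewrite /antipode_code tE.
apply: (@odd_card_involution _ _ antipode_code) => x /H [e [t [xE tE vN dt ->]]].
- by apply: on_first_code => //=; rewrite vN.
- rewrite [RHS]xE /antipode_code /= (val_code (door_cell dt)) -map_comp.
  by rewrite (eq_map (_ : flip \o flip =1 id)) ?map_id // => y; exact: flipK.
apply/eqP => /(congr1 (fun x => val x.1.2)); rewrite /= (val_code (door_cell dt)) tE.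
by case=> /eqP; case: e {xE tE vN dt} => j []; rewrite /flip /= xpair_eqE andbF.
Qed.

Definition origin_door (x : code) : bool := is_door x && (val x.1.2 == [::]).

Lemma card_origin_door : #|origin_door| = 1%N.
Proof.
have c0 : cell [ffun=> ord0] [::].
  by apply/andP; split=> //; apply/forallP => j; rewrite ffunE eqxx.
rewrite -(card1 (code_of [ffun=> ord0] [::] 0)); apply: eq_card => x.
rewrite [LHS]unfold_in [RHS]inE /origin_door; apply/idP/idP.

  case/andP=> /and3P[cx ix _] /eqP tE; apply/eqP.
  rewrite -[LHS]code_ofK tE; move: cx ix; rewrite tE leqn0 => /andP[_ /forallP v0] /eqP ->.
  congr (code_of _ _ _); apply/ffunP => j; rewrite ffunE.
  by apply/eqP; exact: (implyP (v0 j)).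
by move/eqP => ->; rewrite /is_door /= (val_code c0) inordK // /door c0.
Qed.
Lemma card_nat_sum (T : finType) (P : pred T) : #|P| = (\sum_x P x)%N.
Proof.
rewrite -sum1_card big_mkcond; apply: eq_bigr => x _.
by rewrite /in_mem /=; case: (P x).
Qed.

Lemma door_cases v t i : (i <= size t)%N ->
  1%N = ((t == [::]) + (0 < i < size t)%N +
    ((i == 0%N) && (if t is e :: _ then v e.1 < N else false)%N +
     (i == size t) && (if drop (size t).-1 t is e :: _ then v e.1 != ord0 else false)) +
    (i == size t) && (if drop (size t).-1 t is e :: _ then v e.1 == ord0 else false) +
    (i == 0%N) && (if t is e :: _ then val (v e.1) == N else false))%N.
Proof.
case: t => [|e t]; first by rewrite leqn0 => /eqP ->.
have [e1 ->] : exists e1, drop (size (e :: t)).-1 (e :: t) = [:: e1].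
  by exists (last e t); rewrite lastI last_split.
rewrite leq_eqVlt => /predU1P[->|it].
  by rewrite ltnn andbF eqxx /=; case: (v e1.1 == ord0).
rewrite (ltn_eqF it) it andbT /=.
case: i it => // _ /=; have := ltn_ord (v e.1); rewrite ltnS leq_eqVlt.
by case: ltngtP.
Qed.

(** The number of doors is counted modulo 2 in two ways. Cell by cell, the
    cells with two doors cancel and the others are as many as the lower doors.
    Facet by facet, everything cancels except the lower doors and the single
    door of the origin. *)
Theorem tucker : False.
Proof.
have by_cell : #|is_door| = (#|repeated_door| + #|fresh_door|)%N.
  rewrite !card_nat_sum -big_split; apply: eq_bigr => x _ /=.
  by rewrite /repeated_door /fresh_door; case: (is_door x); case: (_ \in _).
have by_facet : #|is_door| = (#|origin_door| + #|inner_door| +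
   (#|on_first (fun v e => v e.1 < N)%N| + #|on_last (fun v e => v e.1 != ord0)|)
   + #|lower_door| + #|outer_door|)%N.
  rewrite !card_nat_sum -!big_split; apply: eq_bigr => x _ /=.
  rewrite /origin_door /inner_door /outer_door /lower_door /on_first /on_last.
  have [dx|] := boolP (is_door x) => //=.
  by rewrite -val_eqE /=; apply: door_cases; case/and3P: dx.
have := congr1 odd by_facet; rewrite by_cell !oddD odd_repeated_door odd_inner_door.
by rewrite odd_outer_door card_rot card_origin_door card_fresh_door addbb /=; case: odd.
Qed.

End labelling.
End kuhn.

(** * The Borsuk-Ulam theorem *)

Section borsuk_ulam.
Variable R : realType.
Local Open Scope classical_set_scope.

Lemma rV_norm_le m (u : 'rV[R]_m) (c : R) : 0 <= c ->
  (forall j, `|u ord0 j| <= c) -> `|u| <= c.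
Proof.
move=> c0 uc; rewrite [leLHS]/Num.norm /= mx_normrE; apply: bigmax_le => // -[i j] _.
by rewrite ord1.
Qed.

Lemma rV_coord_le m (u : 'rV[R]_m) j : `|u ord0 j| <= `|u|.
Proof.
rewrite [leRHS]/Num.norm /= mx_normrE.
exact: (le_bigmax _ (fun ij : 'I_1 * 'I_m => `|u ij.1 ij.2|) (ord0, j)).
Qed.

(** Compactness of the cube enters through near coverings, applied to the filter
    of all fine enough meshes. *)
Lemma cube_uniform m k (phi : 'I_k -> 'rV[R]_m -> R) (e : R) : 0 < e ->
  (forall i, continuous (phi i)) -> exists N : nat, forall x y : 'rV[R]_m,
  (forall j, `|x ord0 j| <= 1) -> (forall j, `|x ord0 j - y ord0 j| <= N.+1%:R^-1) ->
  forall i, `|phi i x - phi i y| < e.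
Proof.
move=> e0 cphi.
have cK := @rV_compact R m (fun=> `[(-1 : R), 1]%classic) (fun=> @segment_compact R (-1) 1).
set K := (X in compact X) in cK.
pose P (N : nat) (x : 'rV[R]_m) := forall y : 'rV[R]_m,
  (forall j, `|x ord0 j - y ord0 j| <= N.+1%:R^-1) -> forall i, `|phi i x - phi i y| < e.
have : \forall N \near \oo, K `<=` P N.
  have cov := iffLR (compact_near_coveringP K) cK; apply: (cov nat \oo P) => x Kx.
  have e2 : 0 < e / 2 by rewrite divr_gt0.
  have : \forall z \near x, forall i, `|phi i x - phi i z| < e / 2.
    apply: (@filter_forall _ _ (fun i z => `|phi i x - phi i z| < e / 2) (nbhs x) _) => i.
    by move/cvgrPdist_lt: (cphi i x); apply.
  move=> /nbhs_ballP [d /= d0 Hd].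
  have d2 : 0 < d / 2 by rewrite divr_gt0.
  exists (ball x (d / 2), [set N | N.+1%:R^-1 < d / 2]) => /=.
    split; first exact: nbhsx_ballx.
    exact: (near_infty_natSinv_lt (PosNum d2)).
  move=> [x' N] [/= [_ xx'] Nd] y xy i.
  have bx' : ball x d x'.
    split=> // a j; apply: lt_trans (xx' a j) _.
    by rewrite ltr_pdivrMr // ltr_pMr // ltr1n.
  have by_ : ball x d y.
    split=> // a j; have := xx' a j; rewrite ord1 => h1; have h2 := xy j.
    rewrite /ball /= (_ : x ord0 j - y ord0 j =
      (x ord0 j - x' ord0 j) + (x' ord0 j - y ord0 j)); last by ring.
    apply: le_lt_trans (ler_normD _ _) _; rewrite [ltRHS](splitr d).
    by apply: ltr_leD => //; apply: le_trans h2 _; exact: ltW.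
  rewrite (_ : phi i x' - phi i y = (phi i x - phi i y) - (phi i x - phi i x')); last by ring.
  apply: le_lt_trans (ler_normB _ _) _; rewrite [ltRHS](splitr e).
  by apply: ltrD; apply: Hd.
move=> /filter_ex[N HN]; exists N => x y xK; apply: HN => j.
by rewrite /= in_itv /= -ler_norml.
Qed.

Definition peak k (w : 'I_k.+1 -> R) : 'I_k.+1 := [arg max_(i > ord0) `|w i|]%O.

Lemma peak_opp k (w : 'I_k.+1 -> R) : peak (fun i => - w i) = peak w.
Proof.
rewrite /peak (_ : (fun i => `|- w i|) = fun i => `|w i|) //.
by apply/funext => i; rewrite normrN.
Qed.

Lemma peak_ge k (w : 'I_k.+1 -> R) : \sum_i w i ^+ 2 = 1 ->
  k.+1%:R^-1 <= `|w (peak w)|.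
Proof.
move=> w1; rewrite leNgt; apply/negP => lt.
have : \sum_i w i ^+ 2 <= k.+1%:R * `|w (peak w)| ^+ 2.
  rewrite mulr_natl -[k.+1 in leRHS]card_ord -sumr_const; apply: ler_sum => i _.
  rewrite -real_normK ?num_real // ler_pXn2r ?nnegrE //.
  by rewrite /peak; case: arg_maxP => // l _; apply.
rewrite w1 leNgt => /negP; apply.
have k0 : 0 < k.+1%:R :> R by rewrite ltr0n.
apply: (@lt_le_trans _ _ (k.+1%:R * k.+1%:R^-1 ^+ 2)).
  by rewrite ltr_pM2l // ltr_pXn2r ?nnegrE // invr_ge0 ltW.
by rewrite expr2 mulrA divff ?gt_eqF // mul1r invf_le1 // ler1n.
Qed.

(** The cube parametrises the upper hemisphere of S^m by the normalisation of
    (1 - |u|, u), which is odd on the boundary of the cube. Label a grid point by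
    the largest coordinate of its image in S^k, with its sign. Opposite labels
    at neighbouring points would force a jump, so [tucker] applies: the
    [k.+1] coordinates fit among the [m] axes. *)
Theorem borsuk_ulam (m k : nat) : (k < m)%N ->
  ~ has_equivariant_map (sphere R m) (sphere R k).
Proof.
move=> km [f [cf ef]].
pose H (u : 'rV[R]_m) : 'rV[R]_m.+1 :=
  \row_j (if unlift ord0 j is Some j' then u ord0 j' else 1 - `|u|).
have cH : continuous H.
  apply: rV_continuous => j; rewrite /H; under eq_fun do rewrite mxE.
  case: (unlift ord0 j) => [j'|]; first exact: coord_continuous.
  move=> u; apply: continuousB; first exact: cst_continuous.
  exact: norm_continuous.
have H0 u : H u != 0.
  apply/eqP => Hu.
  have u0 : u = 0.
    apply/rowP => j.
    have := congr1 (fun w : 'rV[R]_m.+1 => w ord0 (lift ord0 j)) Hu.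
    by rewrite !mxE liftK.
  have := congr1 (fun w : 'rV[R]_m.+1 => w ord0 ord0) Hu.
  by rewrite !mxE unlift_none u0 normr0 subr0 => /eqP; rewrite oner_eq0.
have HN u : `|u| = 1 -> H (- u) = - H u.
  move=> u1; apply/rowP => j; rewrite !mxE normrN u1 subrr.
  by case: (unlift _ _) => [j'|]; rewrite ?mxE ?oppr0.
have [h [ch hE]] := sphere_normalization cH H0.
have hN u : `|u| = 1 -> h (- u) = Z2inv (h u).
  move=> u1; apply: val_inj; rewrite /= !hE HN // scalerN.
  congr (- ((Num.sqrt _)^-1 *: _)).
  by apply: eq_bigr => i _; rewrite mxE sqrrN.
pose phi (i : 'I_k.+1) (u : 'rV[R]_m) : R := val (f (h u)) ord0 i.
have cphi i : continuous (phi i).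
  move=> u; apply: (@continuous_comp _ _ _ (fun u => val (f (h u)))
    (fun M : 'rV[R]_k.+1 => M ord0 i)); last exact: coord_continuous.
  apply: (@continuous_comp _ _ _ (fun u => f (h u)) (fun x : sphere R k => val x)).
    by apply: (@continuous_comp _ _ _ h f); [exact: ch|exact: cf].
  exact: val_continuous.
have phiN u i : `|u| = 1 -> phi i (- u) = - phi i u.
  by move=> u1; rewrite /phi hN // ef /= mxE.
have phi1 u : \sum_i phi i u ^+ 2 = 1 by exact: (set_valP (f (h u))).
have k0 : 0 < k.+1%:R^-1 :> R by rewrite invr_gt0 ltr0n.
have [N HNu] := cube_uniform k0 cphi.
have N0 : 0 < N.+1%:R :> R by rewrite ltr0n.
pose grid (p : 'I_m -> int) : 'rV[R]_m := \row_j ((p j)%:~R / N.+1%:R).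
pose pk p := peak (fun i => phi i (grid p)).
pose lam p : dir m := (widen_ord km (pk p), 0 < phi (pk p) (grid p)).
have grid_coord p j : `|grid p ord0 j| = (absz (p j))%:R / N.+1%:R.
  by rewrite mxE normrM -intr_norm -abszE normfV normr_nat.
apply: (@tucker m N lam).
- move=> p q p1 q1 pq; apply/eqP => /= E.
  have := congr1 snd E; have /(congr1 val) /= pkE := congr1 fst E.
  have {}pkE : pk q = pk p by exact: val_inj.
  rewrite /lam /= pkE => sE.
  have close : `|phi (pk p) (grid p) - phi (pk p) (grid q)| < k.+1%:R^-1.
    apply: HNu => j.
      by rewrite grid_coord ler_pdivrMr // mul1r ler_nat.
    rewrite !mxE -mulrBl -intrB normrM -intr_norm -abszE normfV normr_nat.
    by rewrite -[leRHS]mul1r ler_pM2r ?invr_gt0 // lern1.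
  have hp : k.+1%:R^-1 <= `|phi (pk p) (grid p)| by exact: peak_ge.
  have hq : k.+1%:R^-1 <= `|phi (pk p) (grid q)| by rewrite -pkE; exact: peak_ge.
  move: sE close hp hq k0; move: (phi _ _) (phi _ _) (_^-1) => a c d.
  case: (ltrP 0 a) => a0 /=.
    move=> /negP/negP; rewrite -leNgt => c0; rewrite (gtr0_norm a0) (ler0_norm c0).
    by move=> ac da dc d0; have := le_lt_trans (ler_norm _) ac; lra.
  move=> c0; rewrite (ler0_norm a0) (gtr0_norm c0) distrC.
  by move=> ac da dc d0; have := le_lt_trans (ler_norm _) ac; lra.
move=> p p1 [j0 pj0].
have g1 : `|grid p| = 1.
  apply/eqP; rewrite eq_le; apply/andP; split.
    by apply: rV_norm_le => // j; rewrite grid_coord ler_pdivrMr // mul1r ler_nat.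
  by apply: le_trans (rV_coord_le _ j0); rewrite grid_coord pj0 divff ?gt_eqF.
have gN : grid (fun j => - p j) = - grid p.
  by apply/rowP => j; rewrite !mxE rmorphN mulNr.
have pkN : pk (fun j => - p j) = pk p.
  rewrite /pk -[RHS]peak_opp; congr peak; apply/funext => i.
  by rewrite gN phiN.
rewrite /lam pkN gN phiN // /flip /=; congr (_, _).
have hp : k.+1%:R^-1 <= `|phi (pk p) (grid p)| by exact: peak_ge.
have : phi (pk p) (grid p) != 0 by rewrite -normr_gt0 (lt_le_trans k0).
by rewrite oppr_gt0; case: ltrgtP.
Qed.

End borsuk_ulam.

(** * Growth of the number of vertices *)

Section growth.
Variable R : realType.

Lemma comp_equivariant (X Y Z : freeZ2space) : has_equivariant_map X Y ->
  has_equivariant_map Y Z -> has_equivariant_map X Z.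
Proof.
move=> [f [cf ef]] [g [cg eg]]; exists (fun x => g (f x)); split.
  by move=> x; apply: (@continuous_comp _ _ _ f g); [exact: cf|exact: cg].
by move=> x; rewrite ef eg.
Qed.

Lemma C0_gt0 : 0 < C0 R.
Proof. exact: lt_le_trans (C0_ge161 R). Qed.

(** Borsuk-Ulam for the composite S^(t-1) -> |B_0(G)| -> S^k gives t - 1 <= k,
    and [k] is bounded by C0 ln^2 (2n + 2). *)
Lemma chromatic_order_ge (G : sgraph) (t : nat) :
  (1 <= #|G|)%N -> triangle_free G -> (1 <= t)%N -> topologically_chromatic R t G ->
  2^-1 * expR (Num.sqrt ((t%:R - 1) / C0 R)) - 1 <= #|G|%:R :> R.
Proof.
move=> n1 tf t1 tG; have [k [Gk kC]] := box_index_bound R tf n1.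
have tk : (t.-1 <= k)%N.
  by rewrite leqNgt; apply/negP => /borsuk_ulam; apply; exact: comp_equivariant tG Gk.
have C0p := C0_gt0.
have tE : t%:R - 1 = t.-1%:R :> R by rewrite -[in LHS](prednK t1) -natr1 addrK.
have n1R : 1 <= #|G|%:R :> R by rewrite ler1n.
move: kC; set n : R := #|G|%:R in n1R *.
set L := ln (2 * n); set L' := ln (2 * n + 2) => kC.
have LL : L <= L' by rewrite ler_ln ?posrE; lra.
have L'0 : 0 <= L' by rewrite ln_ge0; lra.
have le : (t%:R - 1) / C0 R <= L' ^+ 2.
  rewrite ler_pdivrMr // tE mulrC expr2 mulrA.
  apply: (@le_trans _ _ (k%:R)); first by rewrite ler_nat.
  by apply: le_trans kC _; rewrite ler_wpM2r // ler_wpM2l // ltW.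
have : expR (Num.sqrt ((t%:R - 1) / C0 R)) <= 2 * n + 2.
  rewrite -[leRHS]lnK ?posrE; last by lra.
  rewrite ler_expR -/L' -[leRHS](ger0_norm L'0) -sqrtr_sqr ler_sqrt //.
  exact: sqr_ge0.
by move: (expR _) => p; lra.
Qed.

Lemma expR_ge_pow (s : R) (k : nat) : 0 <= s -> (s / k.+1%:R) ^+ k.+1 <= expR s.
Proof.
move=> s0; have k0 : 0 < k.+1%:R :> R by rewrite ltr0n.
have -> : expR s = expR (s / k.+1%:R) ^+ k.+1.
  by rewrite -expRM_natl mulrC divfK // gt_eqF.
rewrite ler_pXn2r ?nnegrE ?expR_ge0 ?divr_ge0 ?(ltW k0) //.
by apply: le_trans (expR_ge1Dx _); rewrite lerDr.
Qed.

(** The inequality exp s >= (s / k)^k with k = 2 d + 2 and s^2 of the order of [t]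
    yields a multiple of t^(d + 1), one power more than required. *)
Lemma superpolynomial (d : nat) (C : R) : exists t0 : nat, forall t : nat,
  (t0 <= t)%N ->
  C * t%:R ^+ d <= 2^-1 * expR (Num.sqrt ((t%:R - 1) / C0 R)) - 1.
Proof.
have C0p := C0_gt0.
pose k := (2 * d).+1.
pose a : R := ((2 * C0 R)^-1) ^+ d.+1 / k.+1%:R ^+ k.+1.
have a0 : 0 < a.
  by rewrite divr_gt0 ?exprn_gt0 ?invr_gt0 ?mulr_gt0 ?ltr0n.
exists (Num.truncn ((`|C| + 1) * 2 / a)).+2 => t tt.
have t2 : 2 <= t%:R :> R by rewrite (ler_nat _ 2); apply: leq_trans tt.
have ta : (`|C| + 1) * 2 / a <= t%:R.
  apply: ltW; apply: lt_le_trans (truncnS_gt _) _; rewrite ler_nat.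
  exact: leq_trans (leqnSn _) tt.
have key : a * t%:R ^+ d.+1 <= expR (Num.sqrt ((t%:R - 1) / C0 R)).
  apply: le_trans (expR_ge_pow k (sqrtr_ge0 _)).
  rewrite exprMn exprVn (_ : k.+1 = 2 * d.+1)%N; last by rewrite /k; lia.
  rewrite [X in _ <= X / _]exprM sqr_sqrtr; last by rewrite divr_ge0 ?(ltW C0p) //; lra.
  rewrite /a (_ : k.+1 = 2 * d.+1)%N; last by rewrite /k; lia.
  rewrite mulrAC ler_pM2r ?invr_gt0 ?exprn_gt0 ?ltr0n // -exprMn.
  rewrite ler_pXn2r ?nnegrE ?mulr_ge0 ?invr_ge0 ?(ltW C0p) //; try lra.
  by rewrite invfM mulrAC ler_pM2r ?invr_gt0 //; lra.
have td : 1 <= t%:R ^+ d :> R by rewrite exprn_ege1 //; lra.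
have : (`|C| + 1) * 2 * t%:R ^+ d <= a * t%:R ^+ d.+1.
  rewrite exprS mulrA; apply: ler_wpM2r; first exact: le_trans ler01 td.
  by rewrite [leRHS]mulrC -ler_pdivrMr.
have : C * t%:R ^+ d <= `|C| * t%:R ^+ d.
  by rewrite ler_wpM2r ?ler_norm // (le_trans ler01 td).
move: key td; move: (t%:R ^+ d) (C * _) (a * _) (expR _) => T B A E key td.
rewrite mulrAC mulrDl mul1r; move: (`|C| * T) => F; lra.
Qed.

End growth.

(* The last conjunct spells out superpolynomial growth of n in t.             *)
Theorem corollary3 (R : realType) :
  [/\ forall G : sgraph, (1 <= #|G|)%N -> triangle_free G ->
        (Z2index R (box_space G R) <=
          (C0 R * ln (2 * #|G|%:R) * ln (2 * #|G|%:R + 2))%:E)%E,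
      forall (G : sgraph) (t : nat),
        (1 <= #|G|)%N -> triangle_free G ->
        (1 <= t)%N -> topologically_chromatic R t G ->
        2^-1 * expR (Num.sqrt ((t%:R - 1) / C0 R)) - 1 <= #|G|%:R :> R
    & forall (d : nat) (C : R), exists t0 : nat,
        forall (G : sgraph) (t : nat),
          (1 <= #|G|)%N -> triangle_free G ->
          (1 <= t)%N -> (t0 <= t)%N -> topologically_chromatic R t G ->
          C * t%:R ^+ d <= #|G|%:R :> R].
Proof.
split.
- by move=> G n1 tf; exact: Z2index_box.
- by move=> G t; exact: chromatic_order_ge.
move=> d C; have [t0 Ht0] := superpolynomial d C; exists t0 => G t n1 tf t1 tt tG.
exact: le_trans (Ht0 t tt) (chromatic_order_ge n1 tf t1 tG).
Qed.
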